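(* Let $\lambda=(\lambda_1,\dots,\lambda_r)$ be a partition of $n$. Suppose that either $\lambda$ has at least four distinct parts, or $\lambda$ has exactly three distinct parts $a>b>c$ with $a\neq b+c$. Then $X_\lambda/S_n$ is not Cohen--Macaulay, and hence $X_\lambda$ is not Cohen--Macaulay.
   Context: Work over $\mathbb{C}$. For a partition $\lambda=(\lambda_1\ge\dots\ge\lambda_r)$ of $n$, let $E_\lambda\subset\mathbb{C}^n$ be the subspace defined by $x_1=\cdots=x_{\lambda_1}$, $x_{\lambda_1+1}=\cdots=x_{\lambda_1+\lambda_2}$, ..., $x_{n-\lambda_r+1}=\cdots=x_n$. Let $X_\lambda=S_n\cdot E_\lambda$ be the union of the $S_n$-translates of $E_\lambda$ (a reduced subspace arrangement in $\mathbb{C}^n$, with $S_n$ permuting coordinates), and $X_\lambda/S_n$ the quotient variety, with coordinate ring $\mathcal{O}(X_\lambda)^{S_n}$. *)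

(* Defs.v *)
From HB Require Import structures.
From mathcomp Require Import all_boot all_order all_algebra all_fingroup.
From mathcomp Require Import mpoly complex reals.
Set Implicit Arguments. Unset Strict Implicit. Unset Printing Implicit Defensive.
Import Order.TTheory GRing.Theory Num.Theory.
Local Open Scope ring_scope.

Definition Cx (R : realType) : numClosedFieldType := (R[i])%C.

Definition is_partition (n : nat) (l : seq nat) : Prop :=
  sorted geq l /\ all (fun a => 0 < a)%N l /\ sumn l = n.

(* Index (0-based) of the block of lambda containing coordinate i (0-based):
   coordinates lambda_1+...+lambda_k <= i < lambda_1+...+lambda_{k+1} form block k. *)
Definition blk (l : seq nat) (i : nat) : nat :=
  find (fun k => i < sumn (take k.+1 l))%N (iota 0 (size l)).

Definition in_E (F : Type) (n : nat) (l : seq nat) (x : 'I_n -> F) : Prop :=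
  forall i j : 'I_n, blk l i = blk l j -> x i = x j.

Definition in_X (F : Type) (n : nat) (l : seq nat) (x : 'I_n -> F) : Prop :=
  exists s : 'S_n, in_E l (fun i => x (s i)).

Definition vanish_ideal (F : comRingType) (n : nat) (l : seq nat)
  (p : {mpoly F[n]}) : Prop :=
  forall x : 'I_n -> F, in_X l x -> p.@[x] = 0.

(* Representatives of the S_n-invariant classes of O(X_lambda) = C[x]/I:
   p with s.p - p in I for every s in S_n. *)
Definition invariant_mod (F : comRingType) (n : nat) (I : {mpoly F[n]} -> Prop)
  (p : {mpoly F[n]}) : Prop :=
  forall s : 'S_n, I (msym s p - p).

(* Graded Cohen--Macaulayness of the graded C-algebra A = S / I, where
   S is a set of polynomials (a graded subalgebra of C[x] containing I) and
   I an ideal (homogeneous) of C[x]; elements of A are represented by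
   elements of S, and a = b in A iff a - b \in I.
   Definition: there is a homogeneous system of parameters which is a regular
   sequence, i.e. homogeneous theta_1..theta_d in A of positive degree with
   (i) theta_k a nonzerodivisor on A/(theta_1..theta_{k-1})A for all k, and
   (ii) A/(theta_1..theta_d)A finite-dimensional over C. *)

Definition in_ideal_gen (F : comRingType) (n : nat) (S I : {mpoly F[n]} -> Prop)
  (ths : seq {mpoly F[n]}) (a : {mpoly F[n]}) : Prop :=
  exists cs : seq {mpoly F[n]},
    size cs = size ths /\ (forall c, c \in cs -> S c) /\
    I (a - \sum_(k < size ths) cs`_k * ths`_k).

Definition graded_CM (F : fieldType) (n : nat) (S I : {mpoly F[n]} -> Prop) : Prop :=
  exists ths : seq {mpoly F[n]},
    (forall t, t \in ths -> S t /\ exists d : nat, (0 < d)%N /\ t \is d.-homog)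
    /\ (forall k : nat, (k < size ths)%N -> forall a, S a ->
          in_ideal_gen S I (take k ths) (a * ths`_k) ->
          in_ideal_gen S I (take k ths) a)
    /\ (exists bs : seq {mpoly F[n]}, (forall b, b \in bs -> S b) /\
          forall a, S a -> exists cs : seq F, size cs = size bs /\
            in_ideal_gen S I ths (a - \sum_(k < size bs) cs`_k *: bs`_k)).

Definition X_CM (R : realType) (n : nat) (l : seq nat) : Prop :=
  graded_CM (fun _ : {mpoly (Cx R)[n]} => True) (@vanish_ideal (Cx R) n l).

Definition XmodS_CM (R : realType) (n : nat) (l : seq nat) : Prop :=
  graded_CM (@invariant_mod (Cx R) n (@vanish_ideal (Cx R) n l))
            (@vanish_ideal (Cx R) n l).

(* Main.v *)
Require Import Defs.
From HB Require Import structures.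
From mathcomp Require Import all_boot all_order all_algebra all_fingroup.
From mathcomp Require Import mpoly complex reals.
From mathcomp Require Import boolp ring zify.
Set Implicit Arguments. Unset Strict Implicit. Unset Printing Implicit Defensive.
Import Order.TTheory GRing.Theory Num.Theory.
Local Open Scope ring_scope.

(* A graded Cohen-Macaulay ring [A] is free over the polynomial ring [P] on its
   parameters [theta_1, ..., theta_d], hence it contains every function [f] which
   is multiplied into [A] by elements [g_1, ..., g_d] of [P], the [j]-th one being
   free of [theta_j]: the coefficients of [f] are polynomials by a comparison of
   leading monomials.  Here [A] is the ring of [X_l] or its invariant subring, and
   [f] is an invariant function on the normalization of [X_l], with coordinates the
   common values [y_p] of the blocks.  It is the sum, over the triples of blocks of
   sizes [al 0], [al 1], [al 2], of [f0] of the three values times high powers of all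
   the other differences [y_p - y_q].  The form [f0] of degree five has no term
   linear in [z_i - z_j] along [z_i = z_j]; this makes [f] a polynomial near every
   point with at most one coincidence between the [y_p], because sums of two of the
   [al i] are not parts of [l].  The points with two coincidences have dimension
   [r - 2], so any [d - 1 >= r - 1] parameters satisfy a relation on them, and a power
   of this relation multiplies [f] into [A].
   Finally [f] is not the restriction of a polynomial: a symmetric polynomial
   restricted to three colliding blocks with centre of mass 0 has its term of
   degree five in the span of two fixed forms, while the forms [f0] span a space of
   dimension three. *)

(** The principle behind the proof is Serre's condition S_2: on a Cohen--Macaulay variety a function
    that is regular in codimension one is regular. Freeness over the parameters gives it in
    elementary terms. The sizes [al i] are distinct, and no sum of two of them is a part. By the
    second condition, where blocks of sizes [al i] and [al j] meet, every other component through a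
    general such point also shows two blocks of these sizes, and never one block of size
    [al i + al j]; so one local formula serves all components. For part sizes a > b > c it can fail
    only if a = b + c. By distinctness the third central moment of the merged coordinates is a
    nonzero multiple of t^3; with t^2 it yields all powers t^m, m >= 2. Hence the condition on the
    linear term of [f0]. In weight five, once the first elementary symmetric function is 0, only e_5
    and e_2 e_3 remain, against three quasi-invariants. The number d of parameters is not prescribed
    by [graded_CM]; only r <= d is needed, and a count of monomials gives it. Both rings are
    instances of one argument about a graded subalgebra [S] containing the symmetric polynomials. *)

(** * Polynomials as functions, algebraic dependence, common quotients *)

Lemma poly_eq0_fun (F : numFieldType) (p : {poly F}) :
  (forall s, p.[s] = 0) -> p = 0.
Proof.
move=> p0; apply/eqP; apply: contraT => pN0.
have := max_poly_roots (rs := [seq i%:R | i <- iota 0 (size p)]) pN0.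
rewrite size_map size_iota ltnn; apply.
  by apply/allP => x _; rewrite /root p0.
rewrite map_inj_uniq ?iota_uniq // => i j /eqP.
by rewrite eqr_nat => /eqP.
Qed.

Lemma digits_inj (K n : nat) (f g : 'I_n -> nat) :
  (forall i, f i < K)%N -> (forall i, g i < K)%N ->
  (\sum_(i < n) f i * K ^ i = \sum_(i < n) g i * K ^ i)%N -> f =1 g.
Proof.
elim: n f g => [|n IH] f g fK gK; first by move=> _ i; case: i.
have K0 : (0 < K)%N by apply: leq_ltn_trans (fK ord0).
have E (h : 'I_n.+1 -> nat) : (\sum_(i < n.+1) h i * K ^ i =
   h ord0 + (\sum_(i < n) h (lift ord0 i) * K ^ i) * K)%N.
  rewrite big_ord_recl /= expn0 muln1 big_distrl /=; congr addn.
  by apply: eq_bigr => i _; rewrite expnSr mulnA.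
rewrite !E => e.
have e0 : f ord0 = g ord0.
  have := congr1 (modn^~ K) e.
  by rewrite ![(_ + _ * K)%N]addnC !modnMDl !modn_small.
move: e; rewrite e0 => /addnI /eqP; rewrite eqn_pmul2r // => /eqP e i.
have h := IH (f \o lift ord0) (g \o lift ord0) (fun j => fK _) (fun j => gK _) e.
by have [j ->|->//] := unliftP ord0 i; apply: h.
Qed.

(* Kronecker substitution [y_i = s ^ (K ^ i)] reduces to one variable. *)
Lemma mpoly_eq0_fun (F : numFieldType) n (p : {mpoly F[n]}) :
  (forall y, p.@[y] = 0) -> p = 0.
Proof.
move=> p0; pose K := msize p.
pose code (m : 'X_{1..n}) := (\sum_(i < n) m i * K ^ i)%N.
pose q : {poly F} := \sum_(m <- msupp p) p@_m *: 'X^(code m).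
have q0 : q = 0.
  apply: poly_eq0_fun => s; rewrite -[RHS](p0 (fun i => s ^+ (K ^ i))).
  rewrite /q mevalE horner_sum; apply: eq_bigr => m _.
  rewrite hornerZ hornerXn; congr (_ * _).
  rewrite /code -prodrXr; apply: eq_bigr => i _.
  by rewrite -exprM mulnC.
have small m : m \in msupp p -> forall i, (m i < K)%N.
  move=> /msize_mdeg_lt mK i; apply: leq_ltn_trans mK.
  by rewrite mdegE (bigD1 i) //= leq_addr.
apply/mpolyP => m; rewrite mcoeff0; apply/eqP; apply: contraT => pm.
have mp : m \in msupp p by rewrite mcoeff_msupp.
have := congr1 (fun r : {poly F} => r`_(code m)) q0.
rewrite /q coef_sum coef0 (bigD1_seq m) ?msupp_uniq //= big_seq_cond big1.
  by rewrite coefZ coefXn eqxx mulr1 addr0 => /eqP; rewrite (negPf pm).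
move=> m' /andP[m'p ne]; rewrite coefZ coefXn; case: eqP => [e|]; last by rewrite mulr0.
case/eqP: ne; apply/mnmP => i.
by apply: (@digits_inj K) => //; [exact: small | exact: small].
Qed.

Lemma mpoly_eq_fun (F : numFieldType) n (p q : {mpoly F[n]}) :
  (forall y, p.@[y] = q.@[y]) -> p = q.
Proof.
move=> e; apply/eqP; rewrite -subr_eq0; apply/eqP/mpoly_eq0_fun => y.
by rewrite mevalB e subrr.
Qed.

Lemma linear_dependence (F : fieldType) (I J : finType) (M : I -> J -> F) :
  (#|J| < #|I|)%N ->
  exists c : I -> F, (exists i, c i != 0) /\ forall j, \sum_i c i * M i j = 0.
Proof.
move=> JI; pose A := \matrix_(i < #|I|, j < #|J|) M (enum_val i) (enum_val j).
have kN0 : kermx A != 0.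
  rewrite kermx_eq0 /row_free; apply/negP => /eqP e.
  by have := rank_leq_col A; rewrite e leqNgt JI.
have /rowV0Pn[v vk vN0] := kN0.
have /sub_kermxP vA := vk.
exists (fun i => v 0 (enum_rank i)); split.
  have [/existsP[i hi]|] := boolP [exists i, v 0 i != 0].
    by exists (enum_val i); rewrite enum_valK.
  rewrite negb_exists => /forallP h; case/eqP: vN0; apply/rowP => i.
  by rewrite mxE; apply/eqP; have := h i; rewrite negbK.
move=> j; have := congr1 (fun B : 'rV_ _ => B 0 (enum_rank j)) vA.
rewrite !mxE => h; rewrite -[RHS]h [LHS](reindex (@enum_val I I)) /=; last first.
  by apply: onW_bij; exact: enum_val_bij.
by apply: eq_bigr => i _; rewrite !mxE enum_valK enum_rankK.
Qed.

Lemma card_bmultinom s K : (#|{: 'X_{1..s < K}}| <= K ^ s)%N.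
Proof.
case: K => [|K].
  rewrite (eq_card0 (A := {: 'X_{1..s < 0}})) // => m.
  by have := bmdeg m; rewrite ltn0.
have h (m : 'X_{1..s < K.+1}) i : (m i < K.+1)%N.
  by apply: leq_ltn_trans (bmdeg m); rewrite mdegE (bigD1 i) //= leq_addr.
pose g (m : 'X_{1..s < K.+1}) : {ffun 'I_s -> 'I_K.+1} := [ffun i => Ordinal (h m i)].
rewrite -[X in (_ <= X ^ _)%N]card_ord -[X in (_ <= _ ^ X)%N]card_ord -card_ffun.
apply: (leq_card g) => m1 m2 /ffunP e; apply/val_inj/mnmP => i.
by have := congr1 val (e i); rewrite !ffunE.
Qed.

Lemma msize_prodX (F : fieldType) k s (q : 'I_k -> {mpoly F[s]}) (g : 'I_k -> nat) e :
  (forall i, msize (q i) <= e.+1)%N ->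
  (msize (\prod_i q i ^+ g i) <= (e * \sum_i g i).+1)%N.
Proof.
move=> qe.
have mul (p1 p2 : {mpoly F[s]}) a b : (msize p1 <= a.+1 -> msize p2 <= b.+1 ->
    msize (p1 * p2) <= (a + b).+1)%N.
  have [->|p1N0] := eqVneq p1 0; first by rewrite mul0r msize0.
  have [->|p2N0] := eqVneq p2 0; first by rewrite mulr0 msize0.
  rewrite msizeM //; move: (msize p1) (msize p2) => s1 s2; lia.
have pow (p : {mpoly F[s]}) a m : (msize p <= a.+1 -> msize (p ^+ m) <= (a * m).+1)%N.
  move=> pa; elim: m => [|m IH]; first by rewrite expr0 msize1.
  by rewrite exprS mulnS; apply: mul.
elim/big_ind2: _ => [|a p b p' h h'|i _]; first by rewrite msize1.
  by rewrite mulnDr; apply: mul.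
exact: pow.
Qed.

(** Dimension count: the [B ^ k] products of powers of the [q i] with exponents below [B] lie in a
    space of dimension at most [E ^ s], where [E] is linear in [B]. *)
Lemma mpoly_dep (F : fieldType) s k (q : 'I_k -> {mpoly F[s]}) : (s < k)%N ->
  exists2 p : {mpoly F[k]}, p != 0 & p \mPo [tuple q i | i < k] = 0.
Proof.
move=> sk; pose e := (\max_i msize (q i))%N.
have qe i : (msize (q i) <= e.+1)%N by apply: leqW; exact: (leq_bigmax i).
(* Since [E <= (e * k).+1 * B], this choice gives [E ^ s < B ^ s.+1 <= B ^ k]. *)
pose B := ((e * k).+1 ^ s).+1.
pose E := (e * (k * B)).+1.
have Bc : (E ^ s < B ^ k)%N.
  have ek : (E <= (e * k).+1 * B)%N by rewrite /E mulSn mulnA /B; lia.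
  apply: (@leq_ltn_trans (((e * k).+1 * B) ^ s)); first by case: (posnP s) => [->//|s0]; rewrite leq_exp2r.
  rewrite expnMn.
  apply: (@leq_trans (B * B ^ s)); last by rewrite -expnS leq_pexp2l.
  by rewrite ltn_pmul2r // expn_gt0.
pose I := {ffun 'I_k -> 'I_B}; pose J := 'X_{1..s < E}.
pose v (g : I) := \prod_i q i ^+ g i.
have [|c [[g0 cN0] c0]] := @linear_dependence F I J (fun g m => (v g)@_m).
  apply: leq_ltn_trans (card_bmultinom _ _) _.
  by rewrite card_ffun !card_ord.
pose mn (g : I) : 'X_{1..k} := [multinom val (g i) | i < k].
have mnI : injective mn.
  move=> g g' /mnmP h; apply/ffunP => i; apply: val_inj.
  by have := h i; rewrite !mnmE.
exists (\sum_g c g *: 'X_[mn g]).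
  apply: contraNneq cN0 => /(congr1 (mcoeff (mn g0))).
  rewrite mcoeff0 raddf_sum /= (bigD1 g0) //= big1 ?addr0.
    by rewrite mcoeffZ mcoeffX eqxx mulr1 => ->.
  move=> g gg0; rewrite mcoeffZ mcoeffX; case: eqP => [/mnI e0|]; last by rewrite mulr0.
  by rewrite e0 eqxx in gg0.
have vE g : (msize (v g) <= E)%N.
  apply: leq_trans (msize_prodX (fun i => val (g i)) qe) _; rewrite ltnS leq_mul2l; apply/orP; right.
  apply: (@leq_trans (\sum_(i < k) B)); last by rewrite sum_nat_const card_ord.
  by apply: leq_sum => i _; exact: ltnW (ltn_ord (g i)).
rewrite raddf_sum /=; transitivity (\sum_g c g *: v g).
  apply: eq_bigr => g _; rewrite comp_mpolyZ comp_mpolyX; congr (_ *: _).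
  by apply: eq_bigr => i _; rewrite tnth_mktuple mnmE.
apply/mpolyP => m; rewrite mcoeff0 raddf_sum /=.
have [mE|mE] := ltnP (mdeg m) E; last first.
  apply: big1 => g _; rewrite mcoeffZ [X in _ * X]memN_msupp_eq0 ?mulr0 //.
  by apply: msize_mdeg_ge; apply: leq_trans mE.
rewrite -[RHS](c0 (BMultinom mE)).
by apply: eq_bigr => g _; rewrite mcoeffZ.
Qed.

(** Congruence modulo an ideal respects sums and products. The ideal is a mere predicate because
    [rad_arrangement] applies this to a colon ideal of [rad]. *)
Lemma ideal_subst (F : fieldType) n (K : {mpoly F[n]} -> Prop)
    (t : n.-tuple {mpoly F[n]}) :
  K 0 -> (forall p q, K p -> K q -> K (p + q)) -> (forall p q, K p -> K (q * p)) ->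
  (forall i, K ('X_i - tnth t i)) -> forall p, K (p - (p \mPo t)).
Proof.
move=> K0 KD KM KX.
have KE p q : p = q -> K p -> K q by move=> ->.
have Kmul p q : K (p - (p \mPo t)) -> K (q - (q \mPo t)) -> K (p * q - ((p * q) \mPo t)).
  move=> hp hq; rewrite rmorphM /=.
  apply: (KE (p * (q - (q \mPo t)) + (q \mPo t) * (p - (p \mPo t)))); first by ring.
  by apply: KD; apply: KM.
elim/mpolyind => [|c m p _ _ hp]; first by rewrite raddf0 subrr.
rewrite comp_mpolyD opprD addrACA; apply: KD => //.
rewrite comp_mpolyZ -scalerBr -mul_mpolyC; apply: KM.
rewrite mpolyXE_id; elim/big_ind: _ => [||i _]; first by rewrite rmorph1 subrr.
  exact: Kmul.
elim: (m i) => [|k IH]; first by rewrite expr0 rmorph1 subrr.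
rewrite exprS; apply: Kmul => //; rewrite comp_mpolyXU -tnth_nth.
exact: KX.
Qed.

Lemma mulf_eq0r (R : idomainType) (a b : R) : a != 0 -> a * b = 0 -> b = 0.
Proof. by move=> /negPf aN0 /eqP; rewrite mulf_eq0 aN0 => /eqP. Qed.

(* Leading monomials: [mlead (u j) - mlead (g j)] does not depend on [j], and its
   [j]-th coordinate is nonnegative because [g j] is free of the [j]-th variable. *)
Lemma common_quotient (F : fieldType) d (i0 : 'I_d)
    (g u : 'I_d -> {mpoly F[d]}) :
  (forall j, g j != 0) ->
  (forall j m, m \in msupp (g j) -> m j = 0%N) ->
  (forall i j, g i * u j = g j * u i) ->
  exists phi, forall j, u j = g j * phi.
Proof.
move=> gN0 gfree; move: {2}(mlead _) (erefl (mlead (u i0))) => m.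
elim/(well_founded_ind (@ltom_wf d)): m u => m IH u um gu.
have [u0|u0] := eqVneq (u i0) 0.
  exists 0 => j; rewrite mulr0; apply: (mulf_eq0r (gN0 i0)).
  by rewrite gu u0 mulr0.
have uN0 j : u j != 0.
  apply: contraNneq u0 => uj; apply/eqP/(mulf_eq0r (gN0 j)).
  by rewrite gu uj mulr0.
have lead i j k : (mlead (g i) k + mlead (u j) k = mlead (g j) k + mlead (u i) k)%N.
  by rewrite -mnmDE -mnmDE -(mleadM (gN0 i) (uN0 j)) gu mleadM.
have gj0 j : mlead (g j) j = 0%N by apply: (gfree j); exact: mlead_supp.
pose mu := (mlead (u i0) - mlead (g i0))%MM.
have muE j : (mlead (g j) + mu)%MM = mlead (u j).
  apply/mnmP => k; rewrite mnmDE mnmBE.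
  by have := lead k i0 k; have := lead j i0 k; rewrite gj0; lia.
pose c := (u i0)@_(mlead (u i0)) / (g i0)@_(mlead (g i0)).
have lcN0 (p : {mpoly F[d]}) : p != 0 -> p@_(mlead p) != 0.
  by rewrite mleadc_eq0.
have cE j : (u j)@_(mlead (u j)) = (g j)@_(mlead (g j)) * c.
  have := congr1 (fun p => p@_(mlead (g j) + mlead (u i0))%MM) (gu j i0).
  have -> : (mlead (g j) + mlead (u i0) = mlead (g i0) + mlead (u j))%MM.
    by apply/mnmP => k; rewrite !mnmDE lead.
  rewrite mleadcM => h; rewrite /c mulrA; apply: (canRL (mulfK (lcN0 _ (gN0 i0)))).
  rewrite mulrC -h.
  have -> : (mlead (g i0) + mlead (u j) = mlead (g j) + mlead (u i0))%MM.
    by apply/mnmP => k; rewrite !mnmDE lead.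
  by rewrite mleadcM.
have cN0 : c != 0.
  by apply: contraNneq (lcN0 _ u0) => c0; rewrite cE c0 mulr0.
(* The same term cancels the leading term of every [u j], and the differences satisfy the same
   relations, so the induction on the leading monomial of [u i0] goes on. *)
pose u' j := u j - g j * (c *: 'X_[mu]).
have gu' i j : g i * u' j = g j * u' i.
  by rewrite /u' !mulrBr gu !mulrA [g i * g j]mulrC.
suff [phi hphi] : exists phi, forall j, u' j = g j * phi.
  by exists (phi + c *: 'X_[mu]) => j; rewrite mulrDr -hphi /u' subrK.
have [u'0|u'0] := eqVneq (u' i0) 0.
  exists 0 => j; rewrite mulr0; apply: (mulf_eq0r (gN0 i0)).
  by rewrite gu' u'0 mulr0.
apply: (IH (mlead (u' i0))) => //; rewrite -um.
have := mlead_supp u'0; set m' := mlead _ => m's.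
have lp : mlead (g i0 * (c *: 'X_[mu])) = mlead (u i0).
  have XN0 : 'X_[mu] != 0 :> {mpoly F[d]} by rewrite -msize_poly_eq0 msizeX.
  rewrite mleadM ?gN0 // ?mleadZ ?mleadXm ?muE //.
  by rewrite -mul_mpolyC mulf_neq0 // mpolyC_eq0.
have le_m' : (m' <= mlead (u i0))%O.
  have /(le_trans) := mleadB_le (u i0) (g i0 * (c *: 'X_[mu])).
  by rewrite lp joinxx; exact.
rewrite lt_neqAle le_m' andbT; apply: contraTneq m's => ->.
rewrite mcoeff_msupp negbK mcoeffB -scalerAr mcoeffZ -{2}(muE i0).
by rewrite [(_ + mu)%MM]addmC mcoeffMX cE mulrC subrr.
Qed.

(** * Homogeneous components, and freeness of a graded Cohen--Macaulay ring over its parameters *)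

Lemma homog_scale (F : comNzRingType) n d (p : {mpoly F[n]}) s x :
  p \is d.-homog -> p.@[fun i => s * x i] = s ^+ d * p.@[x].
Proof.
move=> /dhomogP hp; rewrite !mevalE mulr_sumr; apply: eq_big_seq => m mp.
have hd : mdeg m = d := hp m mp.
rewrite mulrCA; congr (_ * _); rewrite -hd mdegE -prodrXr -big_split /=.
by apply: eq_bigr => i _; rewrite exprMn.
Qed.

Lemma meval_scale (F : comNzRingType) n (p : {mpoly F[n]}) s x :
  p.@[fun i => s * x i] = \sum_(d < msize p) s ^+ d * (pihomog mdeg d p).@[x].
Proof.
rewrite {1}(pihomog_partitionE (leqnn (msize p))) raddf_sum /=.
by apply: eq_bigr => d _; apply: homog_scale; exact: pihomogP.
Qed.

Lemma pihomog_msize (F : nzRingType) n d (p : {mpoly F[n]}) :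
  (msize p <= d)%N -> pihomog mdeg d p = 0.
Proof.
move=> pd; rewrite /pihomog big_seq_cond big1 // => m /andP[/msize_mdeg_lt h /eqP e].
by move: h; rewrite e ltnNge pd.
Qed.

Lemma pihomogM (F : fieldType) n D e (c t : {mpoly F[n]}) : t \is e.-homog ->
  pihomog mdeg D (c * t) = if (e <= D)%N then pihomog mdeg (D - e) c * t else 0.
Proof.
move=> te; rewrite {1}(pihomog_partitionE (leqnn (msize c))) mulr_suml raddf_sum /=.
have h k : pihomog mdeg k c * t \is (k + e).-homog by apply: dhomogM => //; exact: pihomogP.
have zero k : (k + e)%N != D -> pihomog mdeg D (pihomog mdeg k c * t) = 0.
  by move=> kD; rewrite (pihomog_ne0 _ (h k)).
have [eD|De] := leqP e D; last first.
  by rewrite big1 // => k _; apply: zero; apply/eqP; lia.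
have [small|big] := leqP (msize c) (D - e).
  rewrite (pihomog_msize small) mul0r big1 // => k _; apply: zero.
  by have := ltn_ord k; move: (msize c) small k => s; lia.
rewrite (bigD1 (Ordinal big)) //= big1 ?addr0.
  by rewrite pihomog_dE // -{2}(subnK eD).
move=> k kne; apply: zero; apply: contraNneq kne => ke.
by apply/eqP/val_inj; rewrite /= -ke addnK.
Qed.

Section Graded.
Context (F : numFieldType) (n : nat) (X : ('I_n -> F) -> Prop).
Context (S : {mpoly F[n]} -> Prop).
Hypothesis Xscale : forall s x, X x -> X (fun i => s * x i).
Hypothesis SC : forall c, S c%:MP.
Hypothesis SD : forall p q, S p -> S q -> S (p + q).
Hypothesis SM : forall p q, S p -> S q -> S (p * q).
Hypothesis Spi : forall d p, S p -> S (pihomog mdeg d p).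

Definition vanish (p : {mpoly F[n]}) := forall x, X x -> p.@[x] = 0.
Local Notation I := vanish.

Lemma sub_zero : S 0. Proof. by rewrite -[0]mpolyC0; exact: SC. Qed.
Lemma sub_scale c p : S p -> S (c *: p).
Proof. by move=> Sp; rewrite -mul_mpolyC; apply: SM. Qed.
Lemma sub_opp p : S p -> S (- p).
Proof. by rewrite -scaleN1r; exact: sub_scale. Qed.
Lemma sub_sum (T : Type) (r : seq T) (P : pred T) (f : T -> {mpoly F[n]}) :
  (forall i, P i -> S (f i)) -> S (\sum_(i <- r | P i) f i).
Proof. by move=> h; elim/big_rec: _ => [|i x Pi Sx]; [exact: sub_zero | apply: SD => //; exact: h]. Qed.
Lemma sub_prod (T : Type) (r : seq T) (P : pred T) (f : T -> {mpoly F[n]}) :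
  (forall i, P i -> S (f i)) -> S (\prod_(i <- r | P i) f i).
Proof.
move=> h; elim/big_rec: _ => [|i x Pi Sx]; first by rewrite -mpolyC1; exact: SC.
by apply: SM => //; exact: h.
Qed.
Lemma sub_exp p k : S p -> S (p ^+ k).
Proof. by move=> h; rewrite -[k]card_ord -prodr_const; apply: sub_prod. Qed.
Lemma sub_comp k (u : {mpoly F[k]}) (t : k.-tuple {mpoly F[n]}) :
  (forall i, S (tnth t i)) -> S (u \mPo t).
Proof.
move=> h; rewrite comp_mpolyEX; apply: sub_sum => m _; apply: sub_scale; rewrite comp_mpolyX.
by apply: sub_prod => i _; apply: sub_exp.
Qed.

Lemma vanish0 : I 0. Proof. by move=> x _; rewrite meval0. Qed.
Lemma vanishD p q : I p -> I q -> I (p + q).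
Proof. by move=> hp hq x Xx; rewrite mevalD hp // hq // addr0. Qed.
Lemma vanishM p q : I q -> I (p * q).
Proof. by move=> hq x Xx; rewrite mevalM hq // mulr0. Qed.

(** As [X] is a cone, p(s x) vanishes as a polynomial in s, and its coefficients are the values at x
    of the homogeneous components. *)
Lemma vanish_pihomog d p : I p -> I (pihomog mdeg d p).
Proof.
move=> Ip x Xx.
have [?|dp] := leqP (msize p) d; first by rewrite pihomog_msize // meval0.
pose q : {poly F} := \poly_(k < msize p) (pihomog mdeg k p).@[x].
have q0 : q = 0.
  apply: poly_eq0_fun => s; rewrite horner_poly -[RHS](Ip _ (Xscale s Xx)) meval_scale.
  by apply: eq_bigr => k _; rewrite mulrC.
by have := coef0 F d; rewrite -q0 coef_poly dp.
Qed.

Section Regular.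
Context (ths : seq {mpoly F[n]}).
Local Notation d := (size ths).
Local Notation tth := (in_tuple ths).

(** [in_ideal_gen] for the first [k] parameters, with coefficients indexed by all of [nat] so that
    no list sizes have to be tracked. *)
Definition inJ (k : nat) (a : {mpoly F[n]}) :=
  exists c : nat -> {mpoly F[n]},
    (forall i, S (c i)) /\ I (a - \sum_(i < k) c i * ths`_i).

Lemma inJP k a : (k <= d)%N -> inJ k a <-> in_ideal_gen S I (take k ths) a.
Proof.
move=> kd; have sk : size (take k ths) = k by rewrite size_takel.
split=> [[c [Sc Ic]]|[cs [scs [Scs Ics]]]].
  exists (mkseq c k); rewrite size_mkseq sk; split=> //; split.
    by move=> p /mapP[i _ ->].
  rewrite (_ : \sum_(i < k) _ = \sum_(i < k) c i * ths`_i) //.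
  by apply: eq_bigr => i _; rewrite nth_mkseq // nth_take.
exists (nth 0 cs); split.
  move=> i; have [ics|ics] := ltnP i (size cs); last by rewrite nth_default //; exact: sub_zero.
  by apply: Scs; exact: mem_nth.
rewrite (_ : \sum_(i < k) _ = \sum_(i < size (take k ths)) cs`_i * (take k ths)`_i) //.
by rewrite sk; apply: eq_bigr => i _; rewrite nth_take.
Qed.

Lemma inJ_D k a b : inJ k a -> inJ k b -> inJ k (a + b).
Proof.
move=> [c [Sc Ic]] [c' [Sc' Ic']]; exists (fun i => c i + c' i); split.
  by move=> i; apply: SD.
rewrite (_ : _ - _ = (a - \sum_(i < k) c i * ths`_i) + (b - \sum_(i < k) c' i * ths`_i)).
  exact: vanishD.
rewrite addrACA -opprD -big_split /=; congr (_ - _).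
by apply: eq_bigr => i _; rewrite mulrDl.
Qed.

Lemma inJ_M k a b : S b -> inJ k a -> inJ k (b * a).
Proof.
move=> Sb [c [Sc Ic]]; exists (fun i => b * c i); split.
  by move=> i; apply: SM.
rewrite (_ : _ - _ = b * (a - \sum_(i < k) c i * ths`_i)); first exact: vanishM.
rewrite mulrBr mulr_sumr; congr (_ - _).
by apply: eq_bigr => i _; rewrite mulrA.
Qed.

Lemma inJ_N k a : inJ k a -> inJ k (- a).
Proof. by move=> h; rewrite -mulN1r; apply: inJ_M => //; apply: sub_opp; exact: (SC 1). Qed.

Lemma inJ_I k a : I a -> inJ k a.
Proof.
move=> Ia; exists (fun _ => 0); split; first by move=> _; exact: sub_zero.
by rewrite big1 ?subr0 // => i _; rewrite mul0r.
Qed.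

Lemma inJ_th k i a : (i < k)%N -> S a -> inJ k (a * ths`_i).
Proof.
move=> ik Sa; exists (fun j => if j == i then a else 0); split.
  by move=> j; case: eqP => _; last exact: sub_zero.
rewrite (bigD1 (Ordinal ik)) //= eqxx big1 ?addr0 ?subrr; first exact: vanish0.
by move=> j /negPf ji; rewrite (_ : (j == i :> nat) = false) ?mul0r.
Qed.

Lemma inJ_mono k k' a : (k <= k')%N -> inJ k a -> inJ k' a.
Proof.
move=> kk [c [Sc Ic]].
rewrite -[a](subrK (\sum_(i < k) c i * ths`_i)); apply: inJ_D; first exact: inJ_I.
elim/big_rec: _ => [|i x _ hx]; first by apply: inJ_I; exact: vanish0.
apply: inJ_D => //; apply: inJ_th => //; apply: leq_trans kk; exact: ltn_ord.
Qed.

Hypothesis Sth : forall t, t \in ths -> S t.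
Hypothesis reg : forall k, (k < d)%N -> forall a, S a ->
  inJ k (a * ths`_k) -> inJ k a.

Lemma Sth_nth (i : 'I_d) : S (tnth tth i).
Proof. by apply: Sth; exact: mem_tnth. Qed.

(** Division by a variable, with the supports of remainder and quotient controlled: [free_mod] needs
    that both inherit the absence of other variables and that the quotient drops in degree. *)
Lemma mpoly_split m (k : 'I_m) (u : {mpoly F[m]}) :
  exists u0 v, [/\ u = u0 + 'X_k * v,
   forall mm, mm \in msupp u0 -> mm \in msupp u /\ mm k = 0%N &
   forall mm, mm \in msupp v -> (mm + U_(k))%MM \in msupp u].
Proof.
elim/mpolyind: u => [|c mm p mp cN0 [u0 [v [e h0 hv]]]].
  by exists 0, 0; split=> [|mm|mm]; rewrite ?mulr0 ?addr0 ?msupp0.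
have supp m' : (m' \in msupp (c *: 'X_[mm] + p)) = (m' == mm) || (m' \in msupp p).
  rewrite !mcoeff_msupp mcoeffD mcoeffZ mcoeffX.
  have [<-|ne] := eqVneq mm m'; first by rewrite mulr1 (memN_msupp_eq0 mp) addr0 cN0.
  by rewrite mulr0 add0r.
have suppZ m' m'' (q : {mpoly F[m]}) : m' \in msupp (c *: 'X_[m''] + q) ->
    m' = m'' \/ m' \in msupp q.
  rewrite mcoeff_msupp mcoeffD mcoeffZ mcoeffX.
  have [->|ne] := eqVneq m'' m'; first by left.
  by rewrite mulr0 add0r -mcoeff_msupp; right.
have [mk|mk] := eqVneq (mm k) 0%N.
  exists (c *: 'X_[mm] + u0), v; split.
  - by rewrite {1}e addrA.
  - move=> m' /suppZ[->|/h0[h1 h2]]; first by rewrite supp eqxx.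
    by rewrite supp h1 orbT.
  - by move=> m' /hv h; rewrite supp h orbT.
exists u0, (c *: 'X_[mm - U_(k)] + v); split.
- rewrite mulrDr -scalerAr -mpolyXD [(U_(k) + _)%MM]addmC submK ?lep1mP //.
  by rewrite {1}e addrCA.
- by move=> m' /h0[h1 h2]; rewrite supp h1 orbT.
- move=> m' /suppZ[->|/hv h]; last by rewrite supp h orbT.
  by rewrite submK ?lep1mP // supp eqxx.
Qed.

Section Free.
Context (T : finType) (A : {set T}) (b : T -> {mpoly F[n]}).
Hypothesis Sb : forall i, S (b i).
Hypothesis indep : forall c : T -> F,
  inJ d (\sum_(i in A) c i *: b i) -> forall i, i \in A -> c i = 0.

(* By downward induction on [k]: a relation is first reduced modulo the [k]-th
   parameter and then divided by it, using regularity. *)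
Lemma free_mod k : (k <= d)%N -> forall D (u : T -> {mpoly F[d]}),
  (forall i, msize (u i) <= D)%N ->
  (forall i m, m \in msupp (u i) -> forall j : 'I_d, (j < k)%N -> m j = 0%N) ->
  inJ k (\sum_(i in A) (u i \mPo tth) * b i) -> forall i, i \in A -> u i = 0.
Proof.
move=> kd; rewrite -(subKn kd); move: (d - k)%N (leq_subr k d) => e.
elim: e => [|e IH] ed.
  rewrite subn0 => D u _ u0 uJ.
  have uC i : u i = ((u i)@_0%MM)%:MP.
    apply/mpolyP => m; rewrite mcoeffC; case: eqP => [->|/eqP mN0]; first by rewrite mulr1.
    rewrite mulr0; apply: memN_msupp_eq0; apply: contra mN0 => /u0 m0.
    by apply/eqP/mnmP => j; rewrite mnm0E m0.
  move=> i iA; rewrite uC (indep (c := fun i => (u i)@_0%MM)) ?mpolyC0 //.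
  rewrite (_ : \sum_(i in A) _ = \sum_(i in A) (u i \mPo tth) * b i) //.
  by apply: eq_bigr => j _; rewrite [in RHS]uC comp_mpolyC mul_mpolyC.
have kd' : (d - e.+1 < d)%N by lia.
have kS : (d - e.+1).+1 = (d - e)%N by lia.
have {}ed : (e <= d)%N by exact: ltnW.
move: (d - e.+1)%N kd' kS => k' kd' kS; rewrite -kS in IH.
pose ko : 'I_d := Ordinal kd'.
(* An inner induction on the degree bound: the outer hypothesis kills the remainders [u0], and the
   quotients [v] satisfy a relation of smaller degree. *)
elim=> [|D IHD] u uD unf uJ i iA.
  by apply/eqP; rewrite -msize_poly_eq0 -leqn0.
have [u0 /choice[v hv]] := choice (fun i => mpoly_split ko (u i)).
have uE i0 : u i0 = u0 i0 + 'X_ko * v i0 by case: (hv i0).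
have Sv i0 : S ((v i0 \mPo tth) * b i0) by apply: SM => //; apply: sub_comp; exact: Sth_nth.
have sumE : \sum_(i in A) (u i \mPo tth) * b i =
    \sum_(i in A) (u0 i \mPo tth) * b i +
    (\sum_(i in A) (v i \mPo tth) * b i) * ths`_k'.
  rewrite mulr_suml -big_split /=; apply: eq_bigr => i0 _.
  rewrite {1}uE comp_mpolyD rmorphM /= comp_mpolyXU mulrDl; congr (_ + _).
  by rewrite -[LHS]mulrA [LHS]mulrC.
have u00 i0 : i0 \in A -> u0 i0 = 0.
  apply: (IH ed D.+1) => [i1|i1 m mu j jk|].
  - apply: leq_trans (uD i1); rewrite [X in (X <= _)%N]msizeE; apply/bigmax_leqP_seq => m mu _.
    by case: (hv i1) => _ h _; apply: msize_mdeg_lt; case: (h m mu).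
  - case: (hv i1) => _ h _; case: (h m mu) => mu1 mk.
    move: jk; rewrite ltnS leq_eqVlt => /orP[/eqP jk|]; last exact: unf mu1 j.
    by rewrite -mk; congr (fun_of_multinom m _); exact: val_inj.
  - rewrite (_ : \sum_(i in A) _ = \sum_(i in A) (u i \mPo tth) * b i -
      (\sum_(i in A) (v i \mPo tth) * b i) * ths`_k'); last by rewrite sumE addrK.
    apply: inJ_D; first exact: inJ_mono uJ.
    by apply/inJ_N/inJ_th => //; apply: sub_sum.
have v0 i0 : i0 \in A -> v i0 = 0.
  apply: IHD => [i1|i1 m mv j jk|].
  - rewrite [X in (X <= _)%N]msizeE; apply/bigmax_leqP_seq => m mv _.
    case: (hv i1) => _ _ h; have := msize_mdeg_lt (h m mv).
    by rewrite mdegD mdeg1 addn1 => /leq_trans/(_ (uD i1)); rewrite ltnS.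
  - case: (hv i1) => _ _ h; have := unf _ _ (h m mv) j jk.
    by rewrite mnmDE => /eqP; rewrite addn_eq0 => /andP[/eqP].
  - apply: reg => //; first by apply: sub_sum.
    move: uJ; rewrite sumE big1 ?add0r // => i2 /u00 ->.
    by rewrite comp_mpoly0 mul0r.
by rewrite uE u00 // v0 // mulr0 addr0.
Qed.

Lemma free_param (u : T -> {mpoly F[d]}) :
  I (\sum_(i in A) (u i \mPo tth) * b i) -> forall i, i \in A -> u i = 0.
Proof.
move=> uI; apply: (@free_mod 0 _ (\max_i msize (u i))) => // [i|]; first exact: leq_bigmax.
exact: inJ_I.
Qed.
End Free.

Section Generate.
Context (T : finType) (A : {set T}) (b : T -> {mpoly F[n]}) (deg : T -> nat).
Hypothesis bdeg : forall i, b i \is (deg i).-homog.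
Hypothesis thdeg : forall t, t \in ths -> exists e, (0 < e)%N /\ t \is e.-homog.
Hypothesis span : forall a, S a -> exists c : T -> F, inJ d (a - \sum_(i in A) c i *: b i).

(** Graded Nakayama: in the degree [D] part of the relation given by [span], the coefficient of a
    parameter of degree [e j > 0] has degree [D - e j], so it is already generated. The size bound
    on the coefficients is kept for the count in [param_count]. *)
Lemma generate_homog D a : S a -> a \is D.-homog ->
  exists u : T -> {mpoly F[d]}, (forall i, msize (u i) <= D.+1)%N /\
    I (a - \sum_(i in A) (u i \mPo tth) * b i).
Proof.
have /choice[e he] : forall j : 'I_d, exists e, (0 < e)%N /\ tnth tth j \is e.-homog.
  by move=> j; apply: thdeg; exact: mem_tnth.
elim/ltn_ind: D a => D IH a Sa aD.
have [c [cs [Scs Ics]]] := span Sa.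
have /choice[w hw] : forall j : 'I_d, exists u : T -> {mpoly F[d]},
    (forall i, msize ('X_j * u i) <= D.+1)%N /\
    I ((if (e j <= D)%N then pihomog mdeg (D - e j) (cs j) else 0)
        - \sum_(i in A) (u i \mPo tth) * b i).
  move=> j; have [e0 ehom] := he j.
  have [eD|_] := leqP (e j) D; last first.
    exists (fun _ => 0); split=> [i|]; first by rewrite mulr0 msize0.
    by rewrite big1 ?subrr ?sub0r ?oppr0; [exact: vanish0|move=> i _; rewrite comp_mpoly0 mul0r].
  have [||u [uD uI]] := IH (D - e j)%N _ _ (Spi (D - e j) (Scs j)).
  - by lia.
  - exact: pihomogP.
  exists u; split=> // i.
  have [->|uN0] := eqVneq (u i) 0; first by rewrite mulr0 msize0.
  rewrite msizeM // -?msize_poly_eq0 ?msizeX ?mdeg1 //=.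
  by apply: leq_trans (_ : (D - e j).+2 <= _)%N; [rewrite ltnS; exact: uD | lia].
exists (fun i => (if deg i == D then c i else 0)%:MP + \sum_j 'X_j * w j i); split.
  move=> i; apply: leq_trans (msizeD_le _ _) _; rewrite geq_max msizeC.
  apply/andP; split; first by case: (_ != 0).
  apply: leq_trans (msize_sum _ _ _) _; apply/bigmax_leqP => j _.
  by have [h _] := hw j; apply: h.
have h := vanish_pihomog D Ics; rewrite !pihomogB pihomog_dE // in h.
set B := pihomog mdeg D (\sum_(i in A) _) in h.
set C := pihomog mdeg D (\sum_(i < d) _) in h.
have eB : B = \sum_(i in A) (if deg i == D then c i else 0) *: b i.
  rewrite /B raddf_sum /=; apply: eq_bigr => i _; rewrite linearZ /=; case: eqP => [<-|/eqP ne].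
    by rewrite pihomog_dE.
  by rewrite (pihomog_ne0 _ (bdeg i)) // scale0r scaler0.
have eC : C = \sum_(j < d) (if (e j <= D)%N then pihomog mdeg (D - e j) (cs j) else 0) * ths`_j.
  rewrite /C raddf_sum /=; apply: eq_bigr => j _; have [_ hj] := he j.
  rewrite -[ths`_j](tnth_nth 0 tth j) (pihomogM D (cs j) hj).
  by case: ifP; rewrite ?mul0r.
have key : I (C - \sum_(j < d) (\sum_(i in A) (w j i \mPo tth) * b i) * ths`_j).
  rewrite eC -sumrB; elim/big_rec: _ => [|j x _ Ix]; first exact: vanish0.
  by apply: vanishD => //; rewrite -mulrBl mulrC; apply: vanishM; have [] := hw j.
have := vanishD h key.
rewrite (_ : a - B - C + _ = a - \sum_(i in A)
  (((if deg i == D then c i else 0)%:MP + \sum_j 'X_j * w j i) \mPo tth) * b i) //.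
rewrite addrA subrK eB -addrA -opprD; congr (_ - _).
rewrite (eq_bigr (fun j => \sum_(i in A) (('X_j * w j i) \mPo tth) * b i)); last first.
  move=> j _; rewrite mulr_suml; apply: eq_bigr => i _.
  by rewrite rmorphM /= comp_mpolyXU mulrC mulrA.
rewrite exchange_big -big_split /=; apply: eq_bigr => i _.
by rewrite comp_mpolyD comp_mpolyC mulrDl mul_mpolyC raddf_sum /= mulr_suml.
Qed.

Lemma generate D a : S a -> (msize a <= D.+1)%N ->
  exists u : T -> {mpoly F[d]}, (forall i, msize (u i) <= D.+1)%N /\
    I (a - \sum_(i in A) (u i \mPo tth) * b i).
Proof.
move=> Sa aD.
have /choice[w hw] : forall k : 'I_D.+1, exists u : T -> {mpoly F[d]},
    (forall i, msize (u i) <= D.+1)%N /\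
    I (pihomog mdeg k a - \sum_(i in A) (u i \mPo tth) * b i).
  move=> k; have [u [uk uI]] := generate_homog (Spi k Sa) (pihomogP _ _ _).
  exists u; split=> // i; apply: leq_trans (uk i) _; exact: ltn_ord.
exists (fun i => \sum_k w k i); split.
  move=> i; apply: leq_trans (msize_sum _ _ _) _; apply/bigmax_leqP => k _.
  by have [h _] := hw k.
rewrite {1}(pihomog_partitionE aD).
rewrite (eq_bigr (fun i => \sum_k (w k i \mPo tth) * b i)); last first.
  by move=> i _; rewrite raddf_sum /= mulr_suml.
rewrite exchange_big -sumrB /=; elim/big_rec: _ => [|j x _ Ix]; first exact: vanish0.
by apply: vanishD => //; have [] := hw j.
Qed.
End Generate.
End Regular.

(** A set of homogeneous elements that is minimal among those spanning [S] modulo the parameters is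
    independent there, since a relation would allow removing one of them. It then generates by
    [generate] and is free by [free_param]. *)
Theorem graded_CM_free : graded_CM S I ->
  exists ths : seq {mpoly F[n]}, (forall t, t \in ths -> S t) /\
  exists (T : finType) (A : {set T}) (b : T -> {mpoly F[n]}),
  [/\ forall i, S (b i),
      forall D a, S a -> (msize a <= D.+1)%N ->
        exists u : T -> {mpoly F[size ths]}, (forall i, msize (u i) <= D.+1)%N /\
          I (a - \sum_(i in A) (u i \mPo in_tuple ths) * b i) &
      forall u : T -> {mpoly F[size ths]},
        I (\sum_(i in A) (u i \mPo in_tuple ths) * b i) -> forall i, i \in A -> u i = 0].
Proof.
move=> [ths [hth [hreg [bs [Sbs hbs]]]]].
have Sth t : t \in ths -> S t by move=> /hth[].
have reg k : (k < size ths)%N -> forall a, S a -> inJ ths k (a * ths`_k) -> inJ ths k a.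
  by move=> kd a Sa /(inJP _ (ltnW kd)) h; apply/(inJP _ (ltnW kd)); apply: hreg.
pose M := \max_(i < size bs) msize bs`_i.
pose T := ('I_(size bs) * 'I_M)%type.
(* The given spanning elements need not be homogeneous; their components span as well. *)
pose b (t : T) := pihomog mdeg t.2 bs`_t.1.
have Sb t : S (b t) by apply/Spi/Sbs/mem_nth.
pose span (A : {set T}) := `[< forall a, S a -> exists c : T -> F,
   inJ ths (size ths) (a - \sum_(i in A) c i *: b i) >].
have spanT : span setT.
  apply/asboolP => a /hbs[cs [scs]]; rewrite -{1}(take_size ths) => /(inJP _ (leqnn _)) h.
  exists (fun t : T => cs`_t.1); congr (inJ _ _ (_ - _)): h.
  rewrite [RHS](eq_bigl xpredT) => [|t]; last by rewrite inE.
  rewrite -(pair_bigA _ (fun (i : 'I_(size bs)) (j : 'I_M) => cs`_i *: pihomog mdeg j bs`_i)) /=.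
  apply: eq_bigr => i _; rewrite -scaler_sumr -pihomog_partitionE //.
  exact: (leq_bigmax i).
have [A /minsetP[/asboolP spanA minA] _] := minset_exists spanT.
exists ths; split=> //; exists T, A, b; split=> //.
- move=> D a Sa; apply: (generate (deg := fun t : T => t.2)) => //.
  + by move=> t; exact: pihomogP.
  + by move=> t /hth[].
- apply: free_param => // c cJ i iA; apply/eqP; apply: contraT => cN0.
  suff /minA/(_ (subD1set _ _)) e : span (A :\ i) by rewrite -e setD11 in iA.
  apply/asboolP => a /spanA[c' hc'].
  exists (fun j => c' j - c' i / c i * c j).
  have := inJ_D hc' (inJ_M (SC (c' i / c i)) cJ).
  congr (inJ _ _ _); rewrite mul_mpolyC scaler_sumr -addrA; congr (_ + _).
  rewrite addrC -sumrB (bigD1 i) //= scalerA divfK // subrr add0r -sumrN.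
  apply: eq_big => [j|j _]; first by rewrite in_setD1 andbC.
  by rewrite scalerA scalerBl opprB.
Qed.
End Graded.

(** * Products of differences, and membership in the radical of an ideal *)

(** Ordered pairs are used, so that a permutation of the variables permutes the factors without
    producing a sign. *)
Definition cross_prod (F : fieldType) n (e : rel 'I_n) : {mpoly F[n]} :=
  \prod_(ij : 'I_n * 'I_n | ~~ e ij.1 ij.2) ('X_ij.1 - 'X_ij.2).

Section Radical.
Context (F : numFieldType) (n : nat) (J : {mpoly F[n]} -> Prop).
Hypothesis J0 : J 0.
Hypothesis JD : forall p q, J p -> J q -> J (p + q).
Hypothesis JM : forall p q, J q -> J (p * q).

Definition rad (p : {mpoly F[n]}) := exists N, J (p ^+ N).

Lemma rad0 : rad 0.
Proof. by exists 1%N; rewrite expr1. Qed.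

Lemma radM p q : rad q -> rad (p * q).
Proof. by move=> [N h]; exists N; rewrite exprMn; apply: JM. Qed.

Lemma radX p k : rad (p ^+ k) -> rad p.
Proof. by move=> [N h]; exists (k * N)%N; rewrite exprM. Qed.

Lemma radD p q : rad p -> rad q -> rad (p + q).
Proof.
move=> [N hN] [M hM]; exists (N + M)%N; rewrite exprDn.
elim/big_rec: _ => // i x _; apply: JD; rewrite -mulr_natl; apply: JM.
have [iM|iM] := leqP M i.
  by rewrite -(subnK iM) exprD mulrA; apply: JM.
by rewrite (_ : N + M - i = (M - i) + N)%N ?exprD 1?mulrC ?mulrA; [apply: JM | lia].
Qed.

(* If no power of [G] were in [J], a prime ideal above [J] avoiding [G] would
   contain exactly the [x_i - x_j] for [i], [j] related by some equivalence
   relation; the induction on the set [T] of the other pairs avoids choosing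
   that prime ideal. *)
Lemma rad_arrangement (G : {mpoly F[n]}) :
  (forall e : rel 'I_n, equivalence_rel e ->
    rad (cross_prod F e) \/
    forall x : 'I_n -> F, (forall i j, e i j -> x i = x j) -> G.@[x] = 0) ->
  rad G.
Proof.
move=> hG; pose L (ij : 'I_n * 'I_n) : {mpoly F[n]} := 'X_ij.1 - 'X_ij.2.
pose M (T : {set 'I_n * 'I_n}) := \prod_(ij in T) L ij.
suff main k (T : {set 'I_n * 'I_n}) : (#|~: T| <= k)%N -> rad (G * M T).
  by have := main _ set0 (leqnn _); rewrite /M big_set0 mulr1.
elim: k T => [|k IH] T.
  (* A full [T] contains a diagonal pair, whose difference is 0, unless [n = 0]; in that case the
     hypothesis on the only relation decides. *)
  rewrite leqn0 cards_eq0 => /eqP Tfull; have [n0|inh] : n = 0%N \/ inhabited 'I_n.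
  - by case: (n) => [|m]; [left | right; constructor; exact: ord0].
  - have [|h|h] := hG (fun _ _ => true); first by move=> x y z.
      rewrite (_ : cross_prod F _ = 1) in h; last by rewrite /cross_prod big1.
      by rewrite -[_ * _]mulr1; apply: radM.
    rewrite (_ : G = 0) ?mul0r; first exact: rad0.
    apply: mpoly_eq0_fun => x; apply: h => -[m lt] j _; exfalso.
    by rewrite n0 ltn0 in lt.
  - case: inh => i; have iT : (i, i) \in T by rewrite -[T]setCK Tfull setC0 inE.
    by rewrite /M (bigD1 _ iT) /= /L /= subrr mul0r mulr0; exact: rad0.
move=> Tk.
have ext a : a \notin T -> rad (G * M (a |: T)).
  move=> aT; apply: IH; rewrite -ltnS; apply: leq_trans Tk.
  by apply: proper_card; rewrite properC; apply/properP; split;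
    [exact: subsetUr | exists a; rewrite ?setU11].
have MU a : a \notin T -> M (a |: T) = L a * M T.
  by move=> aT; rewrite /M big_setU1.
have sq a : a \in T -> M T ^+ 2 = M T * (\prod_(ij in T | ij != a) L ij) * L a.
  by move=> aT; rewrite expr2 {2}/M (bigD1 a) //= [L a * _]mulrC mulrA.
pose e i j := (i, j) \notin T.
have [irr|/negbNE/forallP/= refl] := boolP (~~ [forall i, e i i]).
  move/forallPn: irr => [i0]; rewrite negbK => iT.
  by rewrite /M (bigD1 _ iT) /= /L /= subrr mul0r mulr0; exact: rad0.
(* When the pairs outside [T] do not form an equivalence relation, [M T] has a factor that is a
   combination of differences of pairs outside [T]. Squaring leaves a copy of [M T] beside this
   factor, and [ext] applies. *)
have [nsym|/negbNE/forallP/= sym] := boolP (~~ [forall ij, e ij.1 ij.2 ==> e ij.2 ij.1]).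
  move/forallPn: nsym => [[i j]]; rewrite negb_imply /= /e negbK => /andP[ijT jiT].
  apply: (@radX _ 2); rewrite exprMn (sq _ jiT).
  have -> : L (j, i) = - L (i, j) by rewrite /L /= opprB.
  set P := \prod_(_ in _ | _) _.
  rewrite (_ : G ^+ 2 * _ = (- P * G) * (G * (L (i, j) * M T))).
    by apply: radM; rewrite -MU //; apply: ext.
  by ring.
have [ntr|/negbNE/forallP/= tr] :=
    boolP (~~ [forall ij, [forall k, e ij.1 k ==> e k ij.2 ==> e ij.1 ij.2]]).
  move/forallPn: ntr => [[i j]]; rewrite negb_forall => /existsP[l].
  rewrite /= !negb_imply /e => /and4P[il lj ijT _].
  apply: (@radX _ 2); rewrite exprMn (sq _ ijT).
  have -> : L (i, j) = L (i, l) + L (l, j) by rewrite /L /=; ring.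
  set P := \prod_(_ in _ | _) _.
  rewrite (_ : G ^+ 2 * _ = (P * G) * (G * (L (i, l) * M T)) + (P * G) * (G * (L (l, j) * M T))).
    by rewrite -!MU //; apply: radD; apply: radM; apply: ext.
  by ring.
have esym i j : e i j = e j i.
  by apply/idP/idP => h; [have := sym (i, j) | have := sym (j, i)]; rewrite h.
have etr i j l : e i l -> e l j -> e i j.
  by move=> h1 h2; have /forallP/(_ l) := tr (i, j); rewrite h1 h2.
have eqe : equivalence_rel e.
  move=> i j l; split=> // eij; apply/idP/idP => h; last exact: etr h.
  by apply: etr h; rewrite esym.
have MT : M T = cross_prod F e.
  by apply: eq_bigl => -[i j]; rewrite /e negbK.
have [h|Gv] := hG e eqe; first by rewrite MT; apply: radM.
pose rho i := odflt i [pick j | e i j].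
have erho i : e i (rho i).
  by rewrite /rho; case: pickP => [j|/(_ i)] //=; rewrite refl.
have rhoE i j : e i j -> rho i = rho j.
  move=> eij; rewrite /rho (eq_pick (_ : e i =1 e j)); last first.
    by move=> l; apply/idP/idP => h; apply: etr h; rewrite // esym.
  by case: pickP => [l|/(_ j)] //=; rewrite refl.
(* Replacing each variable by that of its class representative turns [G] into 0 by [Gv], and by
   [ext] it does not change [G] modulo the p for which p * (G * M T) lies in [rad]. *)
pose t := [tuple 'X_(rho i) | i < n] : n.-tuple {mpoly F[n]}.
have Gt : G \mPo t = 0.
  apply: mpoly_eq0_fun => x; rewrite comp_mpoly_meval; apply: Gv => i j eij.
  by rewrite !tnth_mktuple !mevalXU (rhoE _ _ eij).
apply: (@radX _ 2).
have := @ideal_subst F n (fun p => rad (p * (G * M T))) t _ _ _ _ G.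
rewrite Gt subr0 => h; rewrite expr2 [X in rad (X * _)]mulrC -mulrA; apply: radM; apply: h.
- by rewrite mul0r; exact: rad0.
- by move=> p q; rewrite mulrDl; exact: radD.
- by move=> p q; rewrite -mulrA; exact: radM.
- move=> i; rewrite tnth_mktuple mulrCA -[_ - _]/(L (i, rho i)) -MU; last exact: erho.
  by apply: ext; exact: erho.
Qed.
End Radical.

Lemma meval_cross (F : fieldType) n (e : rel 'I_n) x :
  (cross_prod F e).@[x] = \prod_(ij : 'I_n * 'I_n | ~~ e ij.1 ij.2) (x ij.1 - x ij.2).
Proof.
by rewrite rmorph_prod /=; apply: eq_bigr => ij _; rewrite mevalB !mevalXU.
Qed.

Lemma meval_cross0 (F : fieldType) n (e : rel 'I_n) x i j :
  ~~ e i j -> x i = x j -> (cross_prod F e).@[x] = 0.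
Proof. by move=> eij xij; rewrite meval_cross (bigD1 (i, j)) //= xij subrr mul0r. Qed.

Lemma eq_cross (F : fieldType) n (e e' : rel 'I_n) :
  (forall i j, e i j = e' i j) -> cross_prod F e = cross_prod F e'.
Proof. by move=> h; apply: eq_bigl => ij; rewrite h. Qed.

(** * Components as colorings, and gluing of functions on them *)

Section Coloring.
Context (n : nat) (l : seq nat).
Local Notation r := (size l).
Local Notation lam := (nth 0%N l).
Implicit Types (chi : {ffun 'I_n -> 'I_r}) (p q : 'I_r).
Hypothesis lpos : forall p : 'I_r, (0 < lam p)%N.

(* A coloring of content [l] encodes a component of [X_l], namely the set of
   points [y \o chi]. *)
Definition content (chi : {ffun 'I_n -> 'I_r}) : bool :=
  [forall p : 'I_r, #|[pred i | chi i == p]| == lam p].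

(** For colorings of content [l] this means that they encode the same component: they differ by a
    permutation of colors of equal sizes ([same_ker_perm]). *)
Definition same_ker (chi chi' : {ffun 'I_n -> 'I_r}) : bool :=
  [forall i, [forall j, (chi i == chi j) == (chi' i == chi' j)]].

Lemma same_kerP chi chi' :
  reflect (forall i j, (chi i == chi j) = (chi' i == chi' j)) (same_ker chi chi').
Proof.
apply: (iffP forallP) => [h i j|h i]; last by apply/forallP => j; rewrite h.
by have /forallP/(_ j)/eqP := h i.
Qed.

Lemma contentP chi p : content chi -> #|[pred i | chi i == p]| = lam p.
Proof. by move=> /forallP/(_ p)/eqP. Qed.

Lemma content_rep chi : content chi -> exists rep : 'I_r -> 'I_n, forall p, chi (rep p) = p.
Proof.
move=> hc; suff /choice[rep h] : forall p, exists i, chi i = p by exists rep.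
move=> p; have : (0 < #|[pred i | chi i == p]|)%N by rewrite contentP.
by case/card_gt0P => i /eqP; exists i.
Qed.

(** Both colorings use all [r] colors, so the map on colors induced by a refinement is a surjection
    of a finite set onto itself, hence a permutation. *)
Lemma content_refine chi chi' : content chi -> content chi' ->
  (forall i j, chi i = chi j -> chi' i = chi' j) ->
  exists g : {perm 'I_r}, (forall i, chi' i = g (chi i)) /\ forall p, lam (g p) = lam p.
Proof.
move=> hc hc' ref; have [rep hrep] := content_rep hc; have [rep' hrep'] := content_rep hc'.
pose g0 p := chi' (rep p); pose h q := chi (rep' q).
have g0E i : chi' i = g0 (chi i) by apply: ref; rewrite hrep.
have g0h : cancel h g0 by move=> q; rewrite /h -g0E hrep'.
have [k kh hk] := injF_bij (can_inj g0h).
have g0I : injective g0.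
  by move=> p q; rewrite -(hk p) -(hk q) !g0h => ->.
exists (perm g0I); split=> [i|p]; first by rewrite permE.
rewrite -(contentP _ hc') -(contentP _ hc); apply: eq_card => i.
by rewrite !inE permE g0E (inj_eq g0I).
Qed.

Lemma same_ker_perm chi chi' : content chi -> content chi' -> same_ker chi chi' ->
  exists g : {perm 'I_r}, (forall i, chi' i = g (chi i)) /\ forall p, lam (g p) = lam p.
Proof.
move=> hc hc' /same_kerP h; apply: content_refine => // i j /eqP.
by rewrite h => /eqP.
Qed.

Lemma content_perm chi (s : 'S_n) : content chi -> content [ffun i => chi (s i)].
Proof.
move=> hc; apply/forallP => p; rewrite -(contentP p hc); apply/eqP.
rewrite -!sum1_card [RHS](reindex_inj (@perm_inj _ s)) /=.
by apply: eq_bigl => i; rewrite !inE ffunE.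
Qed.

Section Glue.
Context (F : numFieldType).

Definition ker_prod (chi : {ffun 'I_n -> 'I_r}) : {mpoly F[n]} :=
  cross_prod F (fun i j => chi i == chi j).

(** If every two indices of equal color in [chi'] had equal color in [chi], the kernels would agree
    by [content_refine]; so some factor of [ker_prod chi] vanishes. *)
Lemma ker_prod_eq0 chi chi' y : content chi -> content chi' -> ~~ same_ker chi chi' ->
  (ker_prod chi).@[fun i => y (chi' i)] = 0 :> F.
Proof.
move=> hc hc' nk; have [/forallP h|] := boolP [forall i, [forall j, (chi' i == chi' j) ==> (chi i == chi j)]].
  have [|g [gE _]] := content_refine hc' hc.
    by move=> i j /eqP e; have /forallP/(_ j) := h i; rewrite e => /eqP.
  by case/negP: nk; apply/same_kerP => i j; rewrite !gE (inj_eq perm_inj).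
case/forallPn => i /forallPn[j]; rewrite negb_imply => /andP[/eqP e ne].
by apply: (@meval_cross0 F n (fun i j => chi i == chi j) _ i j ne); rewrite e.
Qed.

(* The product [ker_prod chi] vanishes on all components but that of [chi]. *)
Lemma glue (h : {ffun 'I_n -> 'I_r} -> ('I_r -> F) -> F) :
  (forall chi, content chi -> exists q : {mpoly F[r]}, forall y,
     h chi y = (ker_prod chi).@[fun i => y (chi i)] * q.@[y]) ->
  (forall chi chi', content chi -> content chi' -> same_ker chi chi' ->
     forall y y', (forall i, y (chi i) = y' (chi' i)) -> h chi y = h chi' y') ->
  exists H : {mpoly F[n]}, forall chi, content chi ->
    forall y, H.@[fun i => y (chi i)] = h chi y.
Proof.
move=> hdiv hcons.
have /choice[w hw] : forall chi, exists w : {mpoly F[n]}, content chi ->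
    forall chi', content chi' -> forall y,
    w.@[fun i => y (chi' i)] = if same_ker chi chi' then h chi' y else 0.
  move=> chi; have [hc|_] := boolP (content chi); last by exists 0.
  have [q hq] := hdiv _ hc; have [rep hrep] := content_rep hc.
  exists (ker_prod chi * (q \mPo [tuple 'X_(rep p) | p < r])) => _ chi' hc' y.
  rewrite mevalM; case: ifP => [sk|/negbT nk]; last by rewrite ker_prod_eq0 // mul0r.
  have /same_kerP skE := sk.
  have chiE i : chi' (rep (chi i)) = chi' i.
    by apply/eqP; rewrite -skE hrep.
  rewrite comp_mpoly_meval.
  have -> : q.@[fun i => (tnth [tuple 'X_(rep p) | p < r] i).@[fun i0 => y (chi' i0)]] =
            q.@[fun p => y (chi' (rep p))].
    by apply: meval_eq => p; rewrite tnth_mktuple mevalXU.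
  have -> : (ker_prod chi).@[fun i => y (chi' i)] =
            (ker_prod chi).@[fun i => (fun p => y (chi' (rep p))) (chi i)].
    by apply: meval_eq => i /=; rewrite chiE.
  by rewrite -hq; apply: hcons => // i; rewrite chiE.
(* The sum over colorings counts each component once for every coloring encoding it, so it is
   divided by this number. *)
pose N chi := #|[pred chi' | content chi' & same_ker chi' chi]|.
exists (\sum_(chi | content chi) (N chi)%:R^-1 *: w chi) => chi hc y.
have sk_sym chi1 chi2 : same_ker chi1 chi2 = same_ker chi2 chi1.
  by apply/same_kerP/same_kerP => h1 i j; rewrite h1.
have N0 : (0 < N chi)%N.
  by apply/card_gt0P; exists chi; rewrite inE hc; apply/same_kerP.
rewrite raddf_sum /= (eq_bigr (fun chi' =>
    if same_ker chi' chi then (N chi)%:R^-1 * h chi y else 0)); last first.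
  move=> chi' hc'; rewrite mevalZ hw //; case: ifP => [sk|_]; last by rewrite mulr0.
  congr (_%:R^-1 * _); apply: eq_card => chi2; rewrite !inE; congr andb.
  move/same_kerP: sk => sk.
  by apply/same_kerP/same_kerP => h1 i j; rewrite h1 sk.
rewrite -big_mkcondr sumr_const -[LHS]mulr_natl mulrA mulfV ?mul1r //.
by rewrite pnatr_eq0 -lt0n.
Qed.

(** The exponent counts the index pairs of colors (p, q): this is the restriction of a [cross_prod]
    to a component, see [cross_color]. *)
Definition color_prod (E : rel 'I_r) : {mpoly F[r]} :=
  \prod_(pq : 'I_r * 'I_r | ~~ E pq.1 pq.2) ('X_pq.1 - 'X_pq.2) ^+ (lam pq.1 * lam pq.2).

Lemma meval_color E y : (color_prod E).@[y] =
  \prod_(pq : 'I_r * 'I_r | ~~ E pq.1 pq.2) (y pq.1 - y pq.2) ^+ (lam pq.1 * lam pq.2).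
Proof.
rewrite rmorph_prod /=; apply: eq_bigr => pq _.
by rewrite rmorphXn /= mevalB !mevalXU.
Qed.

Lemma eq_color E E' : (forall p q, E p q = E' p q) -> color_prod E = color_prod E'.
Proof. by move=> h; apply: eq_bigl => pq; rewrite h. Qed.

Lemma cross_color chi (E : rel 'I_r) y : content chi ->
  (cross_prod F (fun i j => E (chi i) (chi j))).@[fun i => y (chi i)] = (color_prod E).@[y].
Proof.
move=> hc; rewrite meval_cross meval_color.
rewrite (partition_big (fun ij : 'I_n * 'I_n => (chi ij.1, chi ij.2))
  (fun pq : 'I_r * 'I_r => ~~ E pq.1 pq.2)) //=.
apply: eq_bigr => -[p q] /= Epq.
rewrite (eq_bigr (fun _ => y p - y q)); last by move=> [i j] /= /andP[_ /eqP[-> ->]].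
rewrite prodr_const; congr (_ ^+ _).
rewrite -(contentP p hc) -(contentP q hc) -cardX; apply: eq_card => -[i j].
rewrite !inE /= unfold_in /= xpair_eqE; have [->|_] /= := eqVneq (chi i) p; last by rewrite andbF.
by have [->|_] := eqVneq (chi j) q; rewrite ?Epq ?andbF.
Qed.

End Glue.

Lemma sum_content chi (g : 'I_r -> nat) : content chi ->
  (\sum_(x : 'I_n) g (chi x) = \sum_(p < r) lam p * g p)%N.
Proof.
move=> hc; rewrite (partition_big chi predT) //=; apply: eq_bigr => p _.
rewrite (eq_bigr (fun _ => g p)); last by move=> x /eqP ->.
by rewrite sum_nat_const; congr muln; rewrite -(contentP p hc).
Qed.

End Coloring.

(** * Which polynomials multiply the test function into the coordinate ring *)

Lemma eq_sum_squares (a b p q : nat) : (p + q = a + b)%N ->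
  (p * p + q * q = a * a + b * b)%N -> (p = a /\ q = b) \/ (p = b /\ q = a).
Proof.
move=> ad sq; have /eqP : (p%:Z - a%:Z) * (p%:Z - b%:Z) = 0.
  have : (2 * ((p%:Z - a%:Z) * (p%:Z - b%:Z)) = 0)%R.
    have q1 : q%:Z = a%:Z + b%:Z - p%:Z by lia.
    have sqz : p%:Z * p%:Z + q%:Z * q%:Z = a%:Z * a%:Z + b%:Z * b%:Z.
      by rewrite -!PoszM -!PoszD sq.
    move: sqz; rewrite q1 => h.
    rewrite (_ : 2 * _ = p%:Z * p%:Z + (a%:Z + b%:Z - p%:Z) * (a%:Z + b%:Z - p%:Z)
      - (a%:Z * a%:Z + b%:Z * b%:Z)); last by ring.
    by rewrite h subrr.
  by lia.
by rewrite mulf_eq0 => /orP[]/eqP h; [left|right]; lia.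
Qed.

(* The expansion of [f0] along the hyperplane [z_i = z_j], in terms of
   [t = z_i - z_j] and the position [w] of [z_k] relative to the centre of mass of
   [z_i] and [z_j], has no term linear in [t]. *)
Definition quasi_inv_at (F : fieldType) (al : 'I_3 -> nat) (f0 : {mpoly F[3]})
    (i j k : 'I_3) :=
  exists c0 c2 c3 c4 c5 : F, forall z : 'I_3 -> F,
    let t := z i - z j in
    let w := (al i + al j)%:R * z k - (al i)%:R * z i - (al j)%:R * z j in
    f0.@[z] = c0 * w ^+ 5 + c2 * t ^+ 2 * w ^+ 3 + c3 * t ^+ 3 * w ^+ 2
      + c4 * t ^+ 4 * w + c5 * t ^+ 5.

Definition quasi_inv (F : fieldType) (al : 'I_3 -> nat) (f0 : {mpoly F[3]}) :=
  forall i j k : 'I_3, i != j -> k != i -> k != j -> quasi_inv_at al f0 i j k.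

Section Conductor.
Context (F : numFieldType) (n : nat) (l : seq nat).
Local Notation r := (size l).
Local Notation lam := (nth 0%N l).
Implicit Types (chi : {ffun 'I_n -> 'I_r}) (p q : 'I_r).
Hypothesis lpos : forall p, (0 < lam p)%N.
Context (al : 'I_3 -> nat).
Hypothesis alI : injective al.
Hypothesis al0 : forall i, (0 < al i)%N.
Hypothesis al_sum : forall i j p, i != j -> (al i + al j)%N != lam p.
Context (f0 : {mpoly F[3]}).
Hypothesis f0qi : quasi_inv al f0.

Definition triple (t : {ffun 'I_3 -> 'I_r}) : bool := [forall i, lam (t i) == al i].

Definition merge (t : {ffun 'I_3 -> 'I_r}) : rel 'I_r :=
  fun p q => (p == q) || ((p \in codom t) && (q \in codom t)).

Definition test_fun : {mpoly F[r]} :=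
  \sum_(t | triple t) (f0 \mPo [tuple 'X_(t i) | i < 3]) * color_prod F (merge t).

Lemma meval_test y : test_fun.@[y] =
  \sum_(t | triple t) f0.@[fun i => y (t i)] * (color_prod F (merge t)).@[y].
Proof.
rewrite raddf_sum /=; apply: eq_bigr => t _; rewrite mevalM comp_mpoly_meval.
by congr (_ * _); apply: meval_eq => i; rewrite tnth_mktuple mevalXU.
Qed.

(** A renaming of colors of equal sizes permutes the triples. Hence [test_fun] depends on the
    component only and not on the coloring that encodes it. *)
Lemma test_perm (g : {perm 'I_r}) y : (forall p, lam (g p) = lam p) ->
  test_fun.@[fun p => y (g p)] = test_fun.@[y].
Proof.
move=> hg; rewrite !meval_test.
pose G (t : {ffun 'I_3 -> 'I_r}) : {ffun 'I_3 -> 'I_r} := [ffun i => g (t i)].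
have GI : injective G.
  move=> t t' /ffunP e; apply/ffunP => i; apply: (@perm_inj _ g).
  by have := e i; rewrite !ffunE.
rewrite [RHS](reindex_inj GI) /=; apply: eq_big => [t|t _].
  by apply: eq_forallb => i; rewrite ffunE hg.
congr (_ * _); first by apply: meval_eq => i; rewrite ffunE.
rewrite !meval_color.
have gI : injective (fun pq : 'I_r * 'I_r => (g pq.1, g pq.2)).
  by move=> [p q] [p1 q1] [/perm_inj -> /perm_inj ->].
rewrite [RHS](reindex_inj gI) /=.
have mem p : (g p \in codom (G t)) = (p \in codom t).
  apply/codomP/codomP => -[m e]; exists m; last by rewrite e ffunE.
  by move: e; rewrite ffunE => /perm_inj.
by apply: eq_big => [[p q]|[p q] _] /=; rewrite /merge ?(inj_eq perm_inj) ?mem ?hg.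
Qed.

(** The transporter of the single function [test_fun] into the functions on X, rather than the
    conductor of the whole normalization. *)
Definition conductor (c : {mpoly F[n]}) := exists H : {mpoly F[n]},
  forall chi, content chi -> forall y : 'I_r -> F,
  H.@[fun i => y (chi i)] = c.@[fun i => y (chi i)] * test_fun.@[y].

Lemma conductor0 : conductor 0.
Proof. by exists 0 => chi _ y; rewrite !meval0 mul0r. Qed.

Lemma conductorD c c' : conductor c -> conductor c' -> conductor (c + c').
Proof.
move=> [H hH] [H' hH']; exists (H + H') => chi hc y.
by rewrite !mevalD hH // hH' // mulrDl.
Qed.

Lemma conductorM c c' : conductor c' -> conductor (c * c').
Proof.
move=> [H hH]; exists (c * H) => chi hc y.
by rewrite !mevalM hH // mulrA.
Qed.

Lemma test_same_ker chi chi' : content chi -> content chi' -> same_ker chi chi' ->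
  forall y y', (forall i, y (chi i) = y' (chi' i)) -> test_fun.@[y] = test_fun.@[y'].
Proof.
move=> hc hc' sk y y' yy; have [g [gE hg]] := same_ker_perm lpos hc hc' sk.
rewrite -(test_perm y' hg); apply: meval_eq => p.
have [rep hrep] := content_rep lpos hc.
by rewrite -{1}(hrep p) yy gE hrep.
Qed.

(** If [e] records the equal coordinates of a point, this says that the point lies on the component
    of [chi], and [color_rel] then records the equal block values. *)
Definition coarser chi (e : rel 'I_n) := forall i j, chi i = chi j -> e i j.

Definition color_rel chi (e : rel 'I_n) : rel 'I_r :=
  fun p q => [exists i, [exists j, [&& chi i == p, chi j == q & e i j]]].

(* It is enough to approximate [test_fun] by a polynomial up to the factor of
   [ker_prod chi] missing in [cross_prod e]. *)
Lemma conductor_approx (e : rel 'I_n) (v : {mpoly F[n]}) :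
  (forall chi, content chi -> coarser chi e -> exists q : {mpoly F[r]}, forall y,
     (cross_prod F e).@[fun i => y (chi i)] * (test_fun.@[y] - v.@[fun i => y (chi i)]) =
     (ker_prod F chi).@[fun i => y (chi i)] * q.@[y]) ->
  conductor (cross_prod F e).
Proof.
move=> hv; pose h chi (y : 'I_r -> F) :=
  (cross_prod F e).@[fun i => y (chi i)] * (test_fun.@[y] - v.@[fun i => y (chi i)]).
have [chi hc|chi chi' hc hc' sk y y' yy|H hH] := @glue n l lpos F h.
- have [co|nco] := pselect (coarser chi e); first exact: hv.
  exists 0 => y; rewrite meval0 mulr0 /h.
  have [i [j [cij eij]]] : exists i j, chi i = chi j /\ ~~ e i j.
    apply: contrapT => no; apply: nco => i j cij; apply: contrapT => /negP eij.
    by apply: no; exists i, j.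
  by rewrite (meval_cross0 eij) ?mul0r // cij.
- rewrite /h (test_same_ker hc hc' sk yy).
  by have -> : (fun i => y (chi i)) = fun i => y' (chi' i) by exact/funext.
- exists (H + cross_prod F e * v) => chi hc y.
  by rewrite mevalD mevalM hH // /h mulrBr subrK.
Qed.

Lemma color_relE chi e : equivalence_rel e -> coarser chi e ->
  forall i j, e i j = color_rel chi e (chi i) (chi j).
Proof.
move=> eqe co i j; apply/idP/existsP => [eij|[i' /existsP[j' /and3P[/eqP ci /eqP cj e']]]].
  by exists i; apply/existsP; exists j; rewrite !eqxx.
have ii : e i i' by apply: co.
have jj : e j' j by apply: co.
have [refl tr] := (fun x => (eqe x x x).1, fun x y z => (eqe x y z).2).
by rewrite (tr _ _ _ ii) (tr _ _ _ e').
Qed.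

Lemma color_rel_equiv chi e : content chi -> equivalence_rel e -> coarser chi e ->
  equivalence_rel (color_rel chi e).
Proof.
move=> hc eqe co p q s; have [rep hrep] := content_rep lpos hc.
by rewrite -(hrep p) -(hrep q) -(hrep s) -!color_relE //; exact: eqe.
Qed.

Definition at_most_one_merge chi e := forall p q p' q', p != q -> p' != q' ->
  color_rel chi e p q -> color_rel chi e p' q' ->
  (p' = p /\ q' = q) \/ (p' = q /\ q' = p).

Definition pair_rel p q : rel 'I_r :=
  fun a b => (a == b) || ((a == p) || (a == q)) && ((b == p) || (b == q)).

Lemma color_rel_pair chi e p q : content chi -> equivalence_rel e -> coarser chi e ->
  at_most_one_merge chi e -> p != q -> color_rel chi e p q ->
  forall a b, color_rel chi e a b = pair_rel p q a b.
Proof.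
move=> hc eqe co one pq epq a b.
have eqc := color_rel_equiv hc eqe co.
have refl x : color_rel chi e x x by have [] := eqc x x x.
have sym x y : color_rel chi e x y -> color_rel chi e y x.
  by move=> h; have [_ h1] := eqc x y x; rewrite -h1 // refl.
rewrite /pair_rel; have [->|ab] /= := eqVneq a b; first by rewrite refl.
apply/idP/idP => [eab|].
  by have [[-> ->]|[-> ->]] := one _ _ _ _ pq ab epq eab; rewrite !eqxx ?orbT.
move=> /andP[/orP[]/eqP ea /orP[]/eqP eb]; subst a b; rewrite ?eqxx // in ab *.
exact: sym.
Qed.

Lemma color_prod_pair p q : p != q ->
  color_prod F (fun a b => a == b) =
  color_prod F (pair_rel p q) * (('X_p - 'X_q) ^+ (lam p * lam q) * ('X_q - 'X_p) ^+ (lam q * lam p)).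
Proof.
move=> pq; rewrite /color_prod (bigD1 (p, q)) //= (bigD1 (q, p)) /=; last first.
  by rewrite xpair_eqE eq_sym pq /= (negPf pq).
rewrite mulrA [LHS]mulrC; congr (_ * _); apply: eq_bigl => -[a b].
rewrite /pair_rel /= !xpair_eqE; have [->|ab] //= := eqVneq a b.
have [ap|ap] := eqVneq a p; have [bq|bq] := eqVneq b q;
 have [aq|aq] := eqVneq a q; have [bp|bp] := eqVneq b p; subst => //=;
 by rewrite ?eqxx in ab pq *.
Qed.

Lemma color_prod_div p q (E : rel 'I_r) : p != q -> ~~ E p q -> ~~ E q p ->
  exists w, color_prod F E =
    (('X_p - 'X_q) ^+ (lam p * lam q) * ('X_q - 'X_p) ^+ (lam q * lam p)) * w.
Proof.
move=> pq h1 h2; rewrite /color_prod (bigD1 (p, q)) //= (bigD1 (q, p)) /=; last first.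
  by rewrite h2 xpair_eqE eq_sym (negPf pq).
by rewrite mulrA; eexists; reflexivity.
Qed.

(** The divisor is what [cross_prod F e] lacks compared with [ker_prod F chi] when [e] merges only
    the blocks p and q, see [color_prod_pair]. *)
Definition pair_div p q (g : ('I_r -> F) -> F) := exists w : {mpoly F[r]}, forall y,
  g y = (y p - y q) ^+ (lam p * lam q) * (y q - y p) ^+ (lam q * lam p) * w.@[y].

Lemma pair_divC p q g : pair_div q p g -> pair_div p q g.
Proof. by move=> [w h]; exists w => y; rewrite h [_ ^+ _ * _]mulrC. Qed.

Lemma conductor_step chi e v p q : content chi -> equivalence_rel e -> coarser chi e ->
  at_most_one_merge chi e -> p != q -> color_rel chi e p q ->
  pair_div p q (fun y => test_fun.@[y] - v.@[fun i => y (chi i)]) ->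
  exists s : {mpoly F[r]}, forall y,
     (cross_prod F e).@[fun i => y (chi i)] * (test_fun.@[y] - v.@[fun i => y (chi i)]) =
     (ker_prod F chi).@[fun i => y (chi i)] * s.@[y].
Proof.
move=> hc eqe co one pq epq [w hw]; exists w => y; rewrite hw.
rewrite /ker_prod (cross_color (fun a b => a == b) y hc).
rewrite (eq_cross _ (color_relE eqe co)) (cross_color (color_rel chi e) y hc).
rewrite (eq_color _ (color_rel_pair hc eqe co one pq epq)) (color_prod_pair pq).
by rewrite !mevalM !rmorphXn /= !mevalB !mevalXU !mulrA.
Qed.

(** If a triple does not contain both p and q, then [merge t] does not relate them, and the product
    over the remaining pairs already contains both powers of their difference. *)
Lemma pair_div_sum (P : pred {ffun 'I_3 -> 'I_r}) p q : p != q ->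
  (forall t, P t -> ~~ ((p \in codom t) && (q \in codom t))) ->
  pair_div p q (fun y => \sum_(t | P t)
     f0.@[fun i => y (t i)] * (color_prod F (merge t)).@[y]).
Proof.
move=> pq hP.
have /choice[w hw] : forall t, exists w, P t -> color_prod F (merge t) =
    (('X_p - 'X_q) ^+ (lam p * lam q) * ('X_q - 'X_p) ^+ (lam q * lam p)) * w.
  move=> t; have [/hP Pt|_] := boolP (P t); last by exists 0.
  have [||w hw] := @color_prod_div p q (merge t) pq.
  - by rewrite /merge (negPf pq).
  - by rewrite /merge eq_sym (negPf pq) andbC.
  by exists w.
exists (\sum_(t | P t) (f0 \mPo [tuple 'X_(t i) | i < 3]) * w t) => y.
rewrite raddf_sum /= mulr_sumr; apply: eq_bigr => t Pt.
rewrite hw // !mevalM comp_mpoly_meval !rmorphXn /= !mevalB !mevalXU.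
rewrite (_ : f0.@[fun i => (tnth [tuple 'X_(t i0) | i0 < 3] i).@[y]] = f0.@[fun i => y (t i)]).
  by rewrite mulrCA !mulrA.
by apply: meval_eq => i; rewrite tnth_mktuple mevalXU.
Qed.

Lemma sum_color_class chi p q (K : {set 'I_n}) (R : nmodType) (g : 'I_r -> R) :
  content chi -> p != q -> (forall x, (x \in K) = (chi x == p) || (chi x == q)) ->
  \sum_(x in K) g (chi x) = g p *+ lam p + g q *+ lam q.
Proof.
move=> hc pq hK; rewrite (bigID (fun x => chi x == p)) /=; congr (_ + _).
  rewrite (eq_bigl (fun x => chi x == p)); last first.
    by move=> x; rewrite hK; case: eqP; rewrite ?andbT ?andbF ?orbT.
  rewrite (eq_bigr (fun _ => g p)); last by move=> x /eqP ->.
  by rewrite sumr_const; congr (_ *+ _); rewrite -(contentP p hc).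
rewrite (eq_bigl (fun x => chi x == q)); last first.
  move=> x; rewrite hK; have [->|_] //= := eqVneq (chi x) p; last by rewrite andbT.
  by rewrite (negPf pq).
rewrite (eq_bigr (fun _ => g q)); last by move=> x /eqP ->.
by rewrite sumr_const; congr (_ *+ _); rewrite -(contentP q hc).
Qed.

Lemma sum_color_classN chi p q (K : {set 'I_n}) (g : 'I_r -> nat) :
  content chi -> p != q -> (forall x, (x \in K) = (chi x == p) || (chi x == q)) ->
  (\sum_(x in K) g (chi x) = lam p * g p + lam q * g q)%N.
Proof.
move=> hc pq hK; rewrite (sum_color_class (R := nat) g hc pq hK).
have E (x m : nat) : (x *+ m)%R = (m * x)%N.
  by elim: m => [|m IH]; rewrite ?mulr0n // mulrS IH.
by rewrite !E.
Qed.

(** The class [K] has [al i + al j] elements, which is not a part, so no coloring can make it a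
    single block; it is a union of two blocks for [chi] as well. Outside [K] the classes of [e] are
    blocks of both colorings. Hence the sum and the sum of squares of the two sizes are the same for
    both colorings, and these determine the sizes. *)
Lemma merge_types chi0 p0 q0 chi p q e i j (K : {set 'I_n}) :
  equivalence_rel e -> i != j ->
  content chi0 -> coarser chi0 e -> at_most_one_merge chi0 e ->
  p0 != q0 -> color_rel chi0 e p0 q0 -> lam p0 = al i -> lam q0 = al j ->
  (forall x, (x \in K) = (chi0 x == p0) || (chi0 x == q0)) ->
  content chi -> coarser chi e -> at_most_one_merge chi e ->
  p != q -> color_rel chi e p q ->
  (forall x, (x \in K) = (chi x == p) || (chi x == q)) /\
  ((lam p = al i /\ lam q = al j) \/ (lam p = al j /\ lam q = al i)).
Proof.
move=> eqe ij hc0 co0 one0 pq0 epq0 lp0 lq0 hK hc co one pq epq.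
have eE0 x x' : e x x' = pair_rel p0 q0 (chi0 x) (chi0 x').
  by rewrite (color_relE eqe co0) (color_rel_pair hc0 eqe co0 one0 pq0 epq0).
have eE x x' : e x x' = pair_rel p q (chi x) (chi x').
  by rewrite (color_relE eqe co) (color_rel_pair hc eqe co one pq epq).
have [rep hrep] := content_rep lpos hc0; pose x0 := rep p0.
have K0 x : (x \in K) = e x0 x.
  rewrite hK eE0 /pair_rel hrep eqxx /= [p0 == _]eq_sym.
  by case: (chi0 x == p0).
have cK : #|K| = (al i + al j)%N.
  rewrite -sum1_card (sum_color_classN (fun _ => 1%N) hc0 pq0 hK).
  by rewrite !muln1 lp0 lq0.
have x0pq : (chi x0 == p) || (chi x0 == q).
  apply: contraT => npq; have := al_sum (chi x0) ij; rewrite -cK -(contentP _ hc) => /eqP[].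
  apply: eq_card => x; rewrite K0 eE /pair_rel (negPf npq) /= orbF inE; exact: eq_sym.
have hK' x : (x \in K) = (chi x == p) || (chi x == q).
  rewrite K0 eE /pair_rel x0pq /= orb_idl // => /eqP <-; exact: x0pq.
split=> //.
have same x : x \notin K -> lam (chi x) = lam (chi0 x).
  move=> xK; rewrite -(contentP _ hc) -(contentP _ hc0); apply: eq_card => x'.
  have h := xK; have h0 := xK; rewrite hK' in h; rewrite hK in h0.
  have := eE0 x x'; rewrite eE /pair_rel (negPf h) (negPf h0) /= !orbF !inE.
  by rewrite ![_ == chi x']eq_sym ![_ == chi0 x']eq_sym.
have sq : (lam p * lam p + lam q * lam q = al i * al i + al j * al j)%N.
  rewrite -(sum_color_classN (fun c : 'I_r => lam c) hc pq hK').
  rewrite -lp0 -lq0 -(sum_color_classN (fun c : 'I_r => lam c) hc0 pq0 hK).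
  apply/eqP; rewrite -(eqn_add2r (\sum_(x | x \notin K) lam (chi x))).
  rewrite [X in _ == (_ + X)%N](eq_bigr (fun x => lam (chi0 x))); last exact: same.
  rewrite -!(bigID (mem K) predT) /=.
  by rewrite (sum_content (fun c : 'I_r => lam c) hc) (sum_content (fun c : 'I_r => lam c) hc0).
have ad : (lam p + lam q = al i + al j)%N.
  rewrite -cK -sum1_card (sum_color_classN (fun _ => 1%N) hc pq hK').
  by rewrite !muln1.
exact: eq_sum_squares.
Qed.

Lemma third_index (i j : 'I_3) : i != j ->
  exists k, [/\ k != i, k != j & forall m, [|| m == i, m == j | m == k]].
Proof.
pose o0 := @Ordinal 3 0 isT; pose o1 := @Ordinal 3 1 isT; pose o2 := @Ordinal 3 2 isT.
case: i j => [[|[|[|//]]] hi] [[|[|[|//]]] hj] // _; [exists o2|exists o1|exists o2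
  |exists o0|exists o1|exists o0]; by split=> // -[[|[|[|//]]] ?].
Qed.

Section Correction.
Context (e : rel 'I_n) (K : {set 'I_n}) (i j k : 'I_3) (c0 c2 c3 c4 c5 : F).
Hypothesis eqe : equivalence_rel e.
Hypothesis ij : i != j.
Hypothesis ki : k != i.
Hypothesis kj : k != j.
Hypothesis ijk : forall m, [|| m == i, m == j | m == k].
Local Notation a := ((al i)%:R : F).
Local Notation b := ((al j)%:R : F).

Definition psum (m : nat) : {mpoly F[n]} := \sum_(x in K) 'X_x ^+ m.
Definition cls (s : 'I_n) : {set 'I_n} := [set x | e s x].

(* The second and third central moments of the coordinates in [K] are multiples
   of [t ^+ 2] and [t ^+ 3] when [al i] of these coordinates are equal to [u + t]
   and [al j] of them to [u]. *)
Definition mom2 := (a * b)^-1 *: ((a + b) *: psum 2 - psum 1 ^+ 2).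
Definition mom3 := (a * b * (b - a))^-1 *:
  ((a + b) ^+ 2 *: psum 3 - (3%:R * (a + b)) *: (psum 1 * psum 2) + 2%:R *: psum 1 ^+ 3).
Definition rel_pos (s : 'I_n) : {mpoly F[n]} := (a + b) *: 'X_s - psum 1.
(** The expansion of [f0] with each power of t of exponent at least 2 written by moments. It is
    symmetric in the coordinates of [K], so it does not depend on how a component divides [K] into
    two blocks. *)
Definition local_test (s : 'I_n) : {mpoly F[n]} :=
  let w := rel_pos s in
  c0 *: w ^+ 5 + c2 *: (mom2 * w ^+ 3) + c3 *: (mom3 * w ^+ 2) +
  c4 *: (mom2 ^+ 2 * w) + c5 *: (mom2 * mom3).
Definition join_rel (s : 'I_n) : rel 'I_n :=
  fun x y => e x y || ((x \in K :|: cls s) && (y \in K :|: cls s)).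
(** It reproduces the summands of [test_fun] whose triple contains both merged blocks. The sum runs
    over indices instead of classes, so each class of size [al k] is counted [al k] times. *)
Definition correction : {mpoly F[n]} :=
  \sum_(s | (s \notin K) && (#|cls s| == al k))
     (al k)%:R^-1 *: (local_test s * cross_prod F (join_rel s)).

Context (chi : {ffun 'I_n -> 'I_r}) (p q : 'I_r).
Hypothesis hc : content chi.
Hypothesis co : coarser chi e.
Hypothesis one : at_most_one_merge chi e.
Hypothesis pq : p != q.
Hypothesis epq : color_rel chi e p q.
Hypothesis hK : forall x, (x \in K) = (chi x == p) || (chi x == q).
Hypothesis lp : lam p = al i.
Hypothesis lq : lam q = al j.
Hypothesis hf0 : forall z : 'I_3 -> F,
    let t := z i - z j in
    let w := (al i + al j)%:R * z k - (al i)%:R * z i - (al j)%:R * z j in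
    f0.@[z] = c0 * w ^+ 5 + c2 * t ^+ 2 * w ^+ 3 + c3 * t ^+ 3 * w ^+ 2
      + c4 * t ^+ 4 * w + c5 * t ^+ 5.

Definition extend (c : 'I_r) : {ffun 'I_3 -> 'I_r} :=
  [ffun m => if m == i then p else if m == j then q else c].

Lemma extend_i c : extend c i = p. Proof. by rewrite ffunE eqxx. Qed.
Lemma extend_j c : extend c j = q. Proof. by rewrite ffunE eq_sym (negPf ij) eqxx. Qed.
Lemma extend_k c : extend c k = c. Proof. by rewrite ffunE (negPf ki) (negPf kj). Qed.

Lemma codom_extend c s : (s \in codom (extend c)) = [|| s == p, s == q | s == c].
Proof.
apply/codomP/idP => [[m ->]|].
  rewrite ffunE; have [_|_] := eqVneq m i; first by rewrite eqxx.
  by have [_|_] := eqVneq m j; rewrite eqxx ?orbT.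
case/or3P => /eqP ->; [exists i|exists j|exists k]; by rewrite ?extend_i ?extend_j ?extend_k.
Qed.

Lemma triple_extend c : triple (extend c) = (lam c == al k).
Proof.
apply/forallP/eqP => [/(_ k)/eqP|h m]; first by rewrite extend_k.
by case/or3P: (ijk m) => /eqP ->; rewrite ?extend_i ?extend_j ?extend_k ?lp ?lq ?h.
Qed.

Lemma relE x x' : e x x' = pair_rel p q (chi x) (chi x').
Proof. by rewrite (color_relE eqe co) (color_rel_pair hc eqe co one pq epq). Qed.

Lemma meval_psum m (y : 'I_r -> F) :
  (psum m).@[fun x => y (chi x)] = a * y p ^+ m + b * y q ^+ m.
Proof.
rewrite /psum raddf_sum /= (eq_bigr (fun x => (fun c => y c ^+ m) (chi x))); last first.
  by move=> x _; rewrite rmorphXn /= mevalXU.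
by rewrite (sum_color_class (fun c => y c ^+ m) hc pq hK) lp lq !mulr_natl.
Qed.

Lemma meval_local s (y : 'I_r -> F) :
  (local_test s).@[fun x => y (chi x)] = f0.@[fun m => y (extend (chi s) m)].
Proof.
have a0 : a != 0 by rewrite pnatr_eq0 -lt0n.
have b0 : b != 0 by rewrite pnatr_eq0 -lt0n.
(* Here the sizes must differ: with equal sizes the third central moment would be 0. *)
have ba : b - a != 0.
  by rewrite subr_eq0 eqr_nat; apply: contra ij => /eqP/alI ->.
have m2 : mom2.@[fun x => y (chi x)] = (y p - y q) ^+ 2.
  rewrite /mom2 mevalZ mevalB mevalZ rmorphXn /= !meval_psum.
  by field; rewrite a0 b0.
have m3 : mom3.@[fun x => y (chi x)] = (y p - y q) ^+ 3.
  rewrite /mom3 mevalZ mevalD mevalB !mevalZ mevalM rmorphXn /= !meval_psum.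
  by field; rewrite a0 b0 ba.
have wE : (rel_pos s).@[fun x => y (chi x)] = (a + b) * y (chi s) - a * y p - b * y q.
  by rewrite /rel_pos mevalB mevalZ mevalXU meval_psum !expr1 opprD addrA.
rewrite /local_test !mevalD !mevalZ !mevalM m2 m3 wE.
rewrite hf0 /= extend_i extend_j extend_k natrD.
by ring.
Qed.

Lemma meval_correction (y : 'I_r -> F) :
  correction.@[fun x => y (chi x)] =
  \sum_(c : 'I_r | lam c == al k)
     f0.@[fun m => y (extend c m)] * (color_prod F (merge (extend c))).@[y].
Proof.
have lpk : lam p != al k by rewrite lp (inj_eq alI) eq_sym.
have lqk : lam q != al k by rewrite lq (inj_eq alI) eq_sym.
have clsE s : s \notin K -> forall x, (x \in cls s) = (chi x == chi s).
  by rewrite hK => /negPf sK x; rewrite inE relE /pair_rel sK /= orbF eq_sym.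
have cK s : s \notin K -> #|cls s| = lam (chi s).
  move=> sK; rewrite -(contentP _ hc); apply: eq_card => x.
  by rewrite clsE.
rewrite /correction raddf_sum /= (partition_big chi (fun c : 'I_r => lam c == al k)) /=; last first.
  by move=> s /andP[sK]; rewrite cK.
apply: eq_bigr => c lc; rewrite (eq_bigl (fun s => chi s == c)); last first.
  move=> s; have [sc|] := eqVneq (chi s) c; last by rewrite andbF.
  have sK : s \notin K.
    rewrite hK sc negb_or; apply/andP; split.
      by apply: contraNneq lpk => <-.
    by apply: contraNneq lqk => <-.
  by rewrite sK cK // sc lc.
rewrite (eq_bigr (fun _ => (al k)%:R^-1 *
  (f0.@[fun m => y (extend c m)] * (color_prod F (merge (extend c))).@[y]))); last first.
  move=> s /eqP sc; rewrite mevalZ mevalM meval_local sc; congr (_ * (_ * _)).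
  rewrite -(cross_color (merge (extend c)) y hc); congr (_.@[_]); apply: eq_cross => x x'.
  have sK : s \notin K.
    rewrite hK sc negb_or; apply/andP; split.
      by apply: contraNneq lpk => <-.
    by apply: contraNneq lqk => <-.
  rewrite /join_rel !in_setU !clsE // !hK relE /pair_rel /merge !codom_extend sc.
  case: (chi x == chi x') => //=; rewrite -!orbA.
  by case: (chi x == p); case: (chi x == q); case: (chi x' == p); case: (chi x' == q);
    rewrite ?orbT ?andbT ?andbF ?orbF.
rewrite sumr_const (_ : #|_| = al k); last by rewrite -(eqP lc) -(contentP c hc).
by rewrite -[LHS]mulr_natl mulrA mulfV ?mul1r // pnatr_eq0 -lt0n.
Qed.

(** As the three sizes are distinct, a triple containing p and q has them at the places i and j, so
    it is some [extend c]. These summands cancel against [correction], and [pair_div_sum] handles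
    the others. *)
Lemma correction_div :
  pair_div p q (fun y => test_fun.@[y] - correction.@[fun x => y (chi x)]).
Proof.
have lpk : lam p != al k by rewrite lp (inj_eq alI) eq_sym.
have lqk : lam q != al k by rewrite lq (inj_eq alI) eq_sym.
pose P (t : {ffun 'I_3 -> 'I_r}) := triple t && ~~ ((p \in codom t) && (q \in codom t)).
have [t /andP[]//|w hw] := @pair_div_sum P p q pq.
exists w => y; rewrite -hw meval_correction meval_test.
rewrite (bigID (fun t : {ffun 'I_3 -> 'I_r} => (p \in codom t) && (q \in codom t))) /=.
rewrite addrC [X in _ + X - _](_ : _ = \sum_(c : 'I_r | lam c == al k)
   f0.@[fun m => y (extend c m)] * (color_prod F (merge (extend c))).@[y]) ?addrK //.
rewrite (reindex_onto extend (fun t => t k)) /=.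
  apply: eq_bigl => c; rewrite triple_extend !codom_extend !eqxx ?orbT /= andbT extend_k eqxx.
  by rewrite andbT.
move=> t /andP[/forallP tt /andP[/codomP[m pm] /codomP[m' qm]]].
have mi : m = i by apply/alI/eqP; rewrite -lp pm eq_sym.
have mj : m' = j by apply/alI/eqP; rewrite -lq qm eq_sym.
subst m m'; apply/ffunP => m; case/or3P: (ijk m) => /eqP ->.
- by rewrite extend_i.
- by rewrite extend_j.
- by rewrite extend_k.
Qed.
End Correction.

(** One approximation has to serve all components. If some component merges blocks of sizes [al i]
    and [al j] along [e], every merge on another component has the same class and sizes by
    [merge_types], and [correction] works. Otherwise no triple contains a merged pair, and 0
    works. *)
Lemma cross_conductor e : equivalence_rel e ->
  (forall chi, content chi -> coarser chi e -> at_most_one_merge chi e) ->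
  conductor (cross_prod F e).
Proof.
move=> eqe one.
(* Without a merge [cross_prod F e] restricts to [ker_prod F chi] itself, so any [v] will do. *)
have noMerge chi v : content chi -> coarser chi e ->
    (forall p q, p != q -> ~~ color_rel chi e p q) ->
  exists s : {mpoly F[r]}, forall y,
     (cross_prod F e).@[fun i => y (chi i)] * (test_fun.@[y] - v.@[fun i => y (chi i)]) =
     (ker_prod F chi).@[fun i => y (chi i)] * s.@[y].
  move=> hc co nm; exists (test_fun - (v \mPo [tuple 'X_(chi i) | i < n])) => y.
  rewrite mevalB comp_mpoly_meval; congr (_.@[_] * (_ - _)).
    apply: eq_cross => i j; have [cij|cij] := eqVneq (chi i) (chi j); first exact: co.
    by rewrite (color_relE eqe co); apply/negbTE/nm.
  by apply: meval_eq => i; rewrite tnth_mktuple mevalXU.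
have [[chi0 [p0 [q0 [i [j [hc0 co0 pq0 [epq0 ij lp0 lq0]]]]]]]|none] := pselect
  (exists chi p q i j, [/\ content chi, coarser chi e, p != q &
    [/\ color_rel chi e p q, i != j, lam p = al i & lam q = al j]]).
  have [k [ki kj ijk]] := third_index ij.
  have [c0 [c2 [c3 [c4 [c5 hf0]]]]] := f0qi ij ki kj.
  pose K := [set x | (chi0 x == p0) || (chi0 x == q0)].
  have hK0 x : (x \in K) = (chi0 x == p0) || (chi0 x == q0) by rewrite inE.
  apply: (@conductor_approx e (correction e K i j k c0 c2 c3 c4 c5)) => chi hc co.
  have [[p [q [pq epq]]]|nm] := pselect (exists p q, p != q /\ color_rel chi e p q); last first.
    by apply: noMerge => // p q pq; apply/negP => epq; apply: nm; exists p, q.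
  have onec := one _ hc co.
  have [hK types] := merge_types eqe ij hc0 co0 (one _ hc0 co0) pq0 epq0 lp0 lq0 hK0 hc co onec pq epq.
  apply: (conductor_step hc eqe co onec pq epq).
  case: types => -[lp lq]; first exact: correction_div.
  apply: pair_divC; apply: correction_div => //.
  - by rewrite eq_sym.
  - by have [h1 h2] := color_rel_equiv hc eqe co p q p; rewrite -h2.
  - by move=> x; rewrite hK orbC.
apply: (@conductor_approx e 0) => chi hc co.
have [[p [q [pq epq]]]|nm] := pselect (exists p q, p != q /\ color_rel chi e p q); last first.
  by apply: noMerge => // p q pq; apply/negP => epq; apply: nm; exists p, q.
apply: (conductor_step hc eqe co (one _ hc co) pq epq).
have [t tt|w hw] := @pair_div_sum triple p q pq.
  apply/negP => /andP[/codomP[i pi] /codomP[j qj]]; apply: none.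
  have /forallP ht := tt.
  exists chi, p, q, i, j; split=> //; split=> //; last 2 first.
  - by rewrite pi; apply/eqP.
  - by rewrite qj; apply/eqP.
  by apply: contraNneq pq => ij; rewrite pi qj ij.
by exists w => y; rewrite -hw meval0 subr0 meval_test.
Qed.
End Conductor.

(** * The arrangement in terms of colorings *)

Lemma card_interval n a b : (a <= b)%N -> (b <= n)%N ->
  #|[pred i : 'I_n | (a <= i < b)%N]| = (b - a)%N.
Proof.
move=> ab bn; rewrite -sum1_card -(big_mkord (fun i => (a <= i < b)%N) (fun _ => 1%N)).
rewrite (big_cat_nat (leq0n a) (leq_trans ab bn)) /= (big_cat_nat ab bn) /=.
rewrite big_nat_cond big1 => [|i /andP[/andP[_ ia] /andP[ai _]]]; last by rewrite ltnNge ai in ia.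
rewrite [X in (_ + (_ + X))%N]big_nat_cond [X in (_ + (_ + X))%N]big1 => [|i]; last first.
  by move=> /andP[/andP[bi _] /andP[_ ib]]; rewrite ltnNge bi in ib.
rewrite add0n addn0 big_nat_cond (eq_bigl (fun i => (a <= i < b)%N && true)).
  by rewrite -big_nat_cond sum_nat_const_nat muln1.
by move=> i; rewrite andbT andbb.
Qed.

Section Blocks.
Context (n : nat) (l : seq nat).
Hypothesis ln : sumn l = n.
Hypothesis l0 : all (fun a => 0 < a)%N l.
Local Notation r := (size l).
Local Notation lam := (nth 0%N l).

Lemma part_pos (p : 'I_r) : (0 < lam p)%N.
Proof. by have /allP := l0; apply; exact: mem_nth. Qed.

Lemma sumn_takeS k : (k < r)%N -> sumn (take k.+1 l) = (sumn (take k l) + lam k)%N.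
Proof. by move=> kr; rewrite (take_nth 0%N kr) sumn_rcons. Qed.

Lemma sumn_take_mono j k : (j <= k)%N -> (sumn (take j l) <= sumn (take k l))%N.
Proof.
move=> /subnK <-; elim: (k - j)%N => [|m IH] //; apply: leq_trans IH _; rewrite addSn.
have [mr|mr] := ltnP (m + j) r; first by rewrite sumn_takeS ?leq_addr.
by rewrite !take_oversize // ltnW.
Qed.

Lemma blkP i : (i < n)%N -> (blk l i < r)%N /\
  forall p, (p < r)%N -> (blk l i == p) = (sumn (take p l) <= i < sumn (take p.+1 l))%N.
Proof.
move=> iN; pose P k := (i < sumn (take k.+1 l))%N.
have hasP : has P (iota 0 r).
  apply/hasP; exists r.-1.
    rewrite mem_iota /=; have r0 : (0 < r)%N by move: iN; rewrite -ln; case: (l).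
    by rewrite add0n prednK.
  have r0 : (0 < r)%N by move: iN; rewrite -ln; case: (l).
  by rewrite /P prednK // take_size ln.
have br : (blk l i < r)%N.
  by have := hasP; rewrite has_find size_iota.
split=> // p pr.
have bP : P (blk l i).
  by have := nth_find 0%N hasP; rewrite nth_iota.
have before k : (k < blk l i)%N -> ~~ P k.
  move=> kb; have := before_find 0%N kb; rewrite nth_iota ?add0n; last exact: ltn_trans br.
  by move/negbT.
apply/eqP/andP => [<-|[h1 h2]].
  split=> //; have [->|b0] := posnP (blk l i); first by rewrite take0.
  have := before (blk l i).-1; rewrite /P prednK // -leqNgt; exact.
apply/eqP; rewrite eqn_leq; apply/andP; split.
  by rewrite leqNgt; apply/negP => /before; rewrite /P h2.
rewrite leqNgt; apply/negP => bp.
have := leq_trans bP (sumn_take_mono bp).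
by rewrite ltnNge h1.
Qed.

Definition block_coloring : {ffun 'I_n -> 'I_r} :=
  [ffun i : 'I_n => Ordinal (blkP (ltn_ord i)).1].

Lemma block_content : content block_coloring.
Proof.
apply/forallP => p; apply/eqP.
rewrite (eq_card (B := [pred i : 'I_n | (sumn (take p l) <= i < sumn (take p.+1 l))%N])).
  rewrite card_interval ?sumn_takeS ?leq_addr // ?addKn //.
  rewrite -sumn_takeS // -ln -[X in (_ <= sumn X)%N](take_size l).
  exact: sumn_take_mono.
move=> i; rewrite !inE ffunE -(blkP (ltn_ord i)).2 //.
Qed.

Lemma block_coloringE i j :
  (block_coloring i = block_coloring j) <-> (blk l i = blk l j).
Proof.
rewrite !ffunE; split=> [/(congr1 val)//|h]; exact: val_inj.
Qed.

Lemma in_X_scale (F : nzRingType) (s : F) (x : 'I_n -> F) :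
  in_X l x -> in_X l (fun i => s * x i).
Proof. by move=> [g hg]; exists g => i j ij; rewrite (hg i j). Qed.

(** Colorings of the same content take each color equally often, so each is the block coloring
    composed with a permutation of the indices. *)
Lemma in_XP (F : Type) (x : 'I_n -> F) : in_X l x <->
  exists chi : {ffun 'I_n -> 'I_r}, content chi /\
  exists y : 'I_r -> F, x = fun i => y (chi i).
Proof.
split=> [[s hs]|[chi [hc [y ->]]]].
  have [rep hrep] := content_rep part_pos block_content.
  exists [ffun i => block_coloring ((s^-1)%g i)]; split.
    apply/forallP => p; rewrite -(contentP p block_content); apply/eqP.
    rewrite -!sum1_card (reindex_inj (@perm_inj _ s)) /=.
    by apply: eq_bigl => i; rewrite !inE ffunE permK.
  exists (fun p => x (s (rep p))); apply/funext => i; rewrite ffunE.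
  rewrite -{1}(permKV s i); apply: hs; apply/block_coloringE.
  by rewrite hrep.
pose t1 := [tuple chi i | i < n]; pose t2 := [tuple block_coloring i | i < n].
have cnt (f : {ffun 'I_n -> 'I_r}) p : count_mem p [tuple f i | i < n] = #|[pred i | f i == p]|.
  by rewrite -sum1_count big_map -[RHS]sum1_card /= enumT; apply: eq_bigl.
have /tuple_permP[s hs] : perm_eq t2 t1.
  by apply/allP => p _; rewrite /= !cnt !contentP ?block_content.
exists s => i j /block_coloringE bij; congr y.
have E k : block_coloring k = chi (s k).
  have := congr1 (fun t => nth (block_coloring k) t k) hs.
  by rewrite -!tnth_nth !tnth_mktuple.
by rewrite -!E.
Qed.
End Blocks.

(** * There are at least r parameters *)

Lemma msize_homog (F : fieldType) n d (p : {mpoly F[n]}) : p \is d.-homog -> (msize p <= d.+1)%N.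
Proof.
move=> /dhomogP hp; rewrite msizeE; apply/bigmax_leqP_seq => m mp _.
by rewrite ltnS; have /= -> := hp m mp.
Qed.

Lemma msizeM_leq (F : fieldType) n (p q : {mpoly F[n]}) a b :
  (msize p <= a.+1)%N -> (msize q <= b.+1)%N -> (msize (p * q) <= (a + b).+1)%N.
Proof.
have [->|p0] := eqVneq p 0; first by rewrite mul0r msize0.
have [->|q0] := eqVneq q 0; first by rewrite mulr0 msize0.
by rewrite msizeM //; move: (msize p) (msize q) => s1 s2; lia.
Qed.

Lemma root_mesym (F : fieldType) n (x : 'I_n -> F) i :
  x i ^+ n = \sum_(k < n) (- (-1) ^+ k.+1 * (mesym n F k.+1).@[x]) * x i ^+ (n - k.+1).
Proof.
pose cs := [tuple x j | j < n]; pose P := \prod_(c <- cs) ('X - c%:P).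
have sP : size P = n.+1 by rewrite size_prod_XsubC size_tuple.
have coefP (k : 'I_n.+1) : P`_(n - k) = (-1) ^+ k * (mesym n F k).@[x].
  by rewrite mroots_coeff; congr (_ * _); apply: meval_eq => j; rewrite tnth_mktuple.
have : P.[x i] = 0.
  apply/rootP; rewrite root_prod_XsubC; apply/tnthP; exists i.
  by rewrite tnth_mktuple.
rewrite horner_coef sP (reindex_inj rev_ord_inj) /= big_ord_recl /= subSS subn0.
have -> : P`_n = 1 by have := coefP ord0; rewrite subn0 mesym0E expr0 meval1 mulr1.
rewrite mul1r => /eqP; rewrite addr_eq0 => /eqP ->; rewrite -sumrN.
apply: eq_bigr => k _; rewrite /bump /= add1n subSS.
by rewrite (coefP (lift ord0 k)) /= /bump add1n mulNr mulNr.
Qed.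

(** Each [y p] is a coordinate, hence a root of the monic polynomial of degree n in [root_mesym];
    this removes exponents from n on. The degrees of the symmetric coefficients are bounded for the
    sake of [param_count]. *)
Lemma monomial_reduction (F : fieldType) n r (chi : 'I_n -> 'I_r) (rep : 'I_r -> 'I_n) :
  (forall p, chi (rep p) = p) -> forall m : 'X_{1..r},
  exists a : {ffun 'I_r -> 'I_n} -> {mpoly F[n]},
  (forall u, a u \is symmetric /\ (msize (a u) <= (mdeg m).+1)%N) /\
  forall y : 'I_r -> F, \prod_p y p ^+ m p =
    \sum_u (a u).@[fun i => y (chi i)] * \prod_p y p ^+ u p.
Proof.
move=> hrep m; move: {2}(mdeg m) (leqnn (mdeg m)) => D.
have small_case (m0 : 'X_{1..r}) : (forall p, m0 p < n)%N ->
  exists a : {ffun 'I_r -> 'I_n} -> {mpoly F[n]},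
  (forall u, a u \is symmetric /\ (msize (a u) <= (mdeg m0).+1)%N) /\
  forall y : 'I_r -> F, \prod_p y p ^+ m0 p =
    \sum_u (a u).@[fun i => y (chi i)] * \prod_p y p ^+ u p.
  move=> small; pose u0 : {ffun 'I_r -> 'I_n} := [ffun p => Ordinal (small p)].
  exists (fun u => if u == u0 then 1 else 0); split=> [u|y].
    by case: ifP => _; rewrite ?msize1 ?msize0 ?rpred1 ?rpred0.
  rewrite (bigD1 u0) //= eqxx meval1 mul1r [X in _ + X]big1 => [|u /negPf ->]; last first.
    by rewrite meval0 mul0r.
  by rewrite addr0; apply: eq_bigr => p _; rewrite ffunE.
elim: D m => [|D IH] m mD; have [/forallP|] := boolP [forall p, m p < n]%N;
  try exact: small_case; case/forallPn => p; rewrite -leqNgt => np.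
  have n0 : (0 < n)%N by apply: leq_ltn_trans (ltn_ord (rep p)).
  have : (m p <= mdeg m)%N by rewrite mdegE (bigD1 p) //= leq_addr.
  by lia.
pose m' (k : 'I_n) := (m - U_(p) *+ k.+1)%MM.
have m'm k : (m' k + U_(p) *+ k.+1)%MM = m.
  apply: submK; apply/mnm_lepP => q; rewrite mulmnE mnm1E.
  have [<-|] := eqVneq p q; last by rewrite mul0n.
  by rewrite mul1n; apply: leq_trans np; exact: ltn_ord.
have degm' k : (mdeg (m' k) + k.+1 = mdeg m)%N.
  by rewrite -[in RHS](m'm k) mdegD mdegMn mdeg1 mul1n.
have /choice[a ha] : forall k : 'I_n, exists a : {ffun 'I_r -> 'I_n} -> {mpoly F[n]},
  (forall u, a u \is symmetric /\ (msize (a u) <= (mdeg (m' k)).+1)%N) /\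
  forall y : 'I_r -> F, \prod_p y p ^+ m' k p =
    \sum_u (a u).@[fun i => y (chi i)] * \prod_p y p ^+ u p.
  by move=> k; apply: IH; have := degm' k; lia.
exists (fun u => \sum_(k < n) ((- (-1) ^+ k.+1) *: mesym n F k.+1) * a k u); split=> [u|y].
  split.
    apply: rpred_sum => k _; apply: rpredM; last by have [h _] := ha k; have [] := h u.
    by apply: rpredZ; exact: mesym_sym.
  apply: leq_trans (msize_sum _ _ _) _; apply/bigmax_leqP => k _.
  rewrite -(degm' k) addnC; apply: msizeM_leq; last by have [h _] := ha k; have [] := h u.
  by apply: leq_trans (msizeZ_le _ _) _; apply: msize_homog; exact: dhomog_mesym.
pose x i := y (chi i).
have prodE (k : 'I_n) : \prod_q y q ^+ m q = (\prod_q y q ^+ m' k q) * y p ^+ k.+1.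
  rewrite -{1}(m'm k) (bigD1 p) //= [in RHS](bigD1 p) //= mnmDE exprD mulmnE mnm1E eqxx mul1n.
  rewrite mulrAC; congr (_ * _ * _); apply: eq_bigr => q /negPf qp.
  by rewrite mnmDE mulmnE mnm1E eq_sym qp mul0n addn0.
have n0 : (0 < n)%N by apply: leq_ltn_trans (ltn_ord (rep p)).
have yn : y p ^+ n = \sum_(k < n) (- (-1) ^+ k.+1 * (mesym n F k.+1).@[x]) * y p ^+ (n - k.+1).
  by have := root_mesym x (rep p); rewrite /x hrep.
(* The last index: [m' kn] is [m] with n copies of the p-th variable removed, which leaves
   [y p ^+ n] to be rewritten. *)
pose kn : 'I_n := Ordinal (n := n) (m := n.-1) (ltac:(by rewrite prednK)).
have -> : \prod_q y q ^+ m q = \sum_(k < n) (- (-1) ^+ k.+1 * (mesym n F k.+1).@[x]) *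
   \prod_q y q ^+ m' k q.
  rewrite (prodE kn) /= prednK // yn mulr_sumr; apply: eq_bigr => k _.
  rewrite mulrCA; congr (_ * _).
  rewrite (bigD1 p) //= [RHS](bigD1 p) //= mulrAC -exprD; congr (_ ^+ _ * _).
    rewrite !mnmBE !mulmnE !mnm1E eqxx !mul1n /= prednK //.
    by have := ltn_ord k; lia.
  apply: eq_bigr => q /negPf qp.
  by rewrite !mnmBE !mulmnE !mnm1E eq_sym qp !mul0n.
rewrite (eq_bigr (fun k : 'I_n => \sum_u
   (((- (-1) ^+ k.+1) *: mesym n F k.+1) * a k u).@[x] * \prod_p y p ^+ u p)); last first.
  move=> k _; have [_ ->] := ha k; rewrite mulr_sumr; apply: eq_bigr => u _.
  by rewrite mevalM mevalZ !mulrA.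
rewrite exchange_big /=; apply: eq_bigr => u _.
by rewrite raddf_sum /= mulr_suml.
Qed.

(** Growth comparison on one component: the [B ^ r] monomials with exponents below [B] are
    combinations of the functions [V j], whose number grows only like [B ^ d]. *)
Lemma param_count (F : numFieldType) n r d (chi : 'I_n -> 'I_r) (rep : 'I_r -> 'I_n)
    (S : {mpoly F[n]} -> Prop) (T : finType) (A : {set T}) (b : T -> {mpoly F[n]})
    (th : d.-tuple {mpoly F[n]}) :
  (forall p, chi (rep p) = p) -> (forall p, p \is symmetric -> S p) ->
  (forall D a, S a -> (msize a <= D.+1)%N ->
     exists u : T -> {mpoly F[d]}, (forall i, msize (u i) <= D.+1)%N /\
     forall y : 'I_r -> F, a.@[fun i => y (chi i)] =
       (\sum_(i in A) (u i \mPo th) * b i).@[fun i => y (chi i)]) ->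
  (r <= d)%N.
Proof.
move=> hrep Ssym gen; rewrite leqNgt; apply/negP => dr.
(* [C] counts the pairs of a reduced monomial and a basis element. For d < r the choice of [B] gives
   [C * (r.+1 * B) ^ d < B ^ d.+1 <= B ^ r]. *)
pose C := (n ^ r * #|T|)%N.
pose B := (C * r.+1 ^ d).+1; pose D := (r * B)%N.
pose I := {ffun 'I_r -> 'I_B}.
pose J := ({ffun 'I_r -> 'I_n} * T * 'X_{1..d < D.+1})%type.
pose mn (g : I) : 'X_{1..r} := [multinom val (g i) | i < r].
pose V (j : J) (y : 'I_r -> F) :=
  (\prod_i (tnth th i).@[fun i => y (chi i)] ^+ j.2 i) * (b j.1.2).@[fun i => y (chi i)] *
  \prod_p y p ^+ j.1.1 p.
have mnD g : (mdeg (mn g) <= D)%N.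
  rewrite mdegE; apply: (@leq_trans (\sum_(i < r) B)); last by rewrite sum_nat_const card_ord.
  by apply: leq_sum => i _; rewrite mnmE; exact: ltnW (ltn_ord (g i)).
have /choice[M hM] : forall g : I, exists M : J -> F, forall y : 'I_r -> F,
    \prod_p y p ^+ mn g p = \sum_j M j * V j y.
  move=> g; have [a [ha aE]] := monomial_reduction F hrep (mn g).
  have /choice[w hw] : forall u, exists w : T -> {mpoly F[d]}, (forall i, msize (w i) <= D.+1)%N /\
     forall y : 'I_r -> F, (a u).@[fun i => y (chi i)] =
       (\sum_(i in A) (w i \mPo th) * b i).@[fun i => y (chi i)].
    move=> u; have [sa da] := ha u; apply: gen; first exact: Ssym.
    by apply: leq_trans da _; rewrite ltnS.
  exists (fun j : J => if j.1.2 \in A then (w j.1.1 j.1.2)@_j.2 else 0) => y.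
  rewrite aE -(pair_bigA _ (fun (ut : {ffun 'I_r -> 'I_n} * T) (m : 'X_{1..d < D.+1}) =>
    (if ut.2 \in A then (w ut.1 ut.2)@_m else 0) * V (ut, m) y)) /=.
  rewrite -(pair_bigA _ (fun (u : {ffun 'I_r -> 'I_n}) (t : T) => \sum_(m : 'X_{1..d < D.+1})
    (if t \in A then (w u t)@_m else 0) * V (u, t, m) y)) /=.
  apply: eq_bigr => u _; have [wD ->] := hw u.
  rewrite raddf_sum /= mulr_suml big_mkcond /=; apply: eq_bigr => t _.
  case: ifP => _; last by rewrite big1 // => m _; rewrite mul0r.
  rewrite mevalM (comp_mpolywE _ (wD t)) raddf_sum /= !mulr_suml.
  apply: eq_bigr => m _; rewrite mevalZ /V /= rmorph_prod /= !mulrA; congr (_ * _ * _ * _).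
  by apply: eq_bigr => i _; rewrite rmorphXn.
have [|c [[g0 cN0] c0]] := @linear_dependence F I J M.
  rewrite !card_prod card_ffun !card_ord -/C.
  apply: (@leq_ltn_trans (C * D.+1 ^ d)); first by rewrite leq_mul2l card_bmultinom orbT.
  have DB : (D.+1 <= r.+1 * B)%N by rewrite /D mulSn; rewrite addnC -addn1 leq_add2l.
  apply: (@leq_ltn_trans (C * (r.+1 * B) ^ d)).
    rewrite leq_mul2l; apply/orP; right.
    by case: (posnP d) => d0; [rewrite !d0 !expn0 | rewrite leq_exp2r].
  rewrite expnMn mulnA; apply: (@leq_trans (B * B ^ d)).
    by rewrite ltn_pmul2r // expn_gt0.
  by rewrite -expnS card_ffun !card_ord leq_pexp2l.
have mnI : injective mn.
  move=> g g' /mnmP h; apply/ffunP => i; apply: val_inj.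
  by have := h i; rewrite !mnmE.
have p0 : \sum_g c g *: 'X_[mn g] = 0 :> {mpoly F[r]}.
  apply: mpoly_eq0_fun => y; rewrite raddf_sum /=.
  rewrite (eq_bigr (fun g => \sum_j (c g * M g j) * V j y)); last first.
    move=> g _; rewrite mevalZ mevalX hM mulr_sumr.
    by apply: eq_bigr => j _; rewrite mulrA.
  by rewrite exchange_big big1 // => j _; rewrite -mulr_suml c0 mul0r.
case/eqP: cN0; have := congr1 (mcoeff (mn g0)) p0.
rewrite mcoeff0 raddf_sum /= (bigD1 g0) //= [X in _ + X]big1 ?addr0.
  by rewrite mcoeffZ mcoeffX eqxx mulr1.
move=> g gg0; rewrite mcoeffZ mcoeffX (inj_eq mnI) (negPf gg0) mulr0 //.
Qed.

(** * Points with two coincidences, and relations between parameters on them *)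

Definition two_coincidences (T : Type) r (y : 'I_r -> T) := exists p q p' q',
  [/\ p != q, p' != q', y p = y q, y p' = y q' &
      ~ ((p' = p /\ q' = q) \/ (p' = q /\ q' = p))].

(** Two indices u and v can be left out without losing a value of [y], because their values are also
    taken elsewhere; so there are at most [r - 2] values. *)
Lemma two_coincidences_factor (T : eqType) (x0 : T) r (y : 'I_r -> T) :
  (2 < r)%N -> two_coincidences y ->
  exists (phi : {ffun 'I_r -> 'I_(r - 2)}) (z : 'I_(r - 2) -> T), forall p, y p = z (phi p).
Proof.
move=> r2 [p [q [p' [q' [pq pq' ypq ypq' ne]]]]].
suff [u [v [uv hu hv]]] : exists u v, [/\ u != v,
    exists2 a, a \notin [set u; v] & y a = y u & exists2 a, a \notin [set u; v] & y a = y v].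
  pose s := undup (codom y).
  have ss : (size s <= r - 2)%N.
    have e2 : #|~: [set u; v]| = (r - 2)%N by rewrite cardsCs setCK card_ord cards2 uv.
    rewrite -e2 -(size_image y); apply: uniq_leq_size; first exact: undup_uniq.
    move=> _ /[!mem_undup] /codomP[c ->].
    have [|cuv] := boolP (c \in [set u; v]); last first.
      by apply/imageP; exists c; rewrite ?inE // in cuv *.
    rewrite !inE => /orP[]/eqP ->; [case: hu | case: hv] => a ha <-;
      by apply/imageP; exists a => //; rewrite inE.
  have hs m : y m \in s by rewrite mem_undup codom_f.
  have lt m : (index (y m) s < r - 2)%N by apply: leq_trans ss; rewrite index_mem.
  exists [ffun m => Ordinal (lt m)], (fun m => nth x0 s m) => m.
  by rewrite ffunE /= nth_index.
(* The pairs differ, so one member of the first is not in the second; call it q. *)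
wlog hq : p q pq ypq ne / (q != p') && (q != q') => [hw|].
  have [h|h] := boolP ((q != p') && (q != q')); first exact: (hw p q).
  have [h'|h'] := boolP ((p != p') && (p != q')).
    by apply: (hw q p) => //; [rewrite eq_sym | tauto].
  case: ne; move: h h'; rewrite !negb_and !negbK => /orP[]/eqP eq /orP[]/eqP ep;
    subst; rewrite ?eqxx // in pq *; tauto.
have /andP[qp' qq'] := hq.
(* If the pairs share p, the indices q and q' are left out; otherwise q and p' are. *)
have [e|pp'] := eqVneq p p'.
  subst p'; exists q, q'; split=> //.
    by exists p => //; rewrite !inE negb_or pq.
  by exists p => //; rewrite !inE negb_or pq.
exists q, p'; split=> //; first by exists p => //; rewrite !inE negb_or pq.
by exists q' => //; rewrite !inE negb_or eq_sym qq' eq_sym.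
Qed.

(** Independence of a variable is stated by values, which suits products and compositions;
    [free_of_msupp] translates it into supports. *)
Definition free_of (F : fieldType) d (j : 'I_d) (g : {mpoly F[d]}) :=
  forall v v' : 'I_d -> F, (forall k, k != j -> v k = v' k) -> g.@[v] = g.@[v'].

Lemma free_of_prod (F : fieldType) d (j : 'I_d) (I : Type) (s : seq I) (P : pred I) g :
  (forall i, free_of j (g i)) -> free_of (F := F) j (\prod_(i <- s | P i) g i).
Proof.
move=> h v v' vv; rewrite !rmorph_prod /=; apply: eq_bigr => i _; exact: h.
Qed.

Lemma free_of_exp (F : fieldType) d (j : 'I_d) (g : {mpoly F[d]}) N :
  free_of j g -> free_of j (g ^+ N).
Proof. by move=> h v v' vv; rewrite !rmorphXn /= (h v v'). Qed.

Lemma free_of_msupp (F : numFieldType) d (j : 'I_d) (g : {mpoly F[d]}) m :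
  free_of j g -> m \in msupp g -> m j = 0%N.
Proof.
move=> gj; pose t := [tuple if i == j then 0 else 'X_i : {mpoly F[d]} | i < d].
have -> : g = g \mPo t.
  apply: mpoly_eq_fun => v; rewrite comp_mpoly_meval; apply: gj => k kj.
  by rewrite tnth_mktuple (negPf kj) mevalXU.
rewrite comp_mpolyEX => /msupp_sum_le; rewrite filter_predT => /flatten_mapP[m' m'g].
move=> /msuppZ_le; rewrite comp_mpolyX; have [m'j|m'j] := eqVneq (m' j) 0%N.
  rewrite (_ : \prod_i _ = 'X_[m']); first by rewrite msuppX inE => /eqP ->.
  rewrite mpolyXE_id; apply: eq_bigr => i _; rewrite tnth_mktuple.
  by case: eqP => [->|//]; rewrite m'j !expr0.
rewrite (bigD1 j) //= tnth_mktuple eqxx expr0n (negPf m'j) mul0r msupp0.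
by rewrite in_nil.
Qed.

(* The strata with two coincidences have dimension [r - 2 < d - 1]. *)
Lemma stratum_relation (F : numFieldType) n r d (th : d.-tuple {mpoly F[n]}) (j : 'I_d) :
  (2 < r)%N -> (r <= d)%N ->
  exists g : {mpoly F[d]}, [/\ g != 0, free_of j g &
    forall (chi : {ffun 'I_n -> 'I_r}) (y : 'I_r -> F), two_coincidences y ->
      (g \mPo th).@[fun i => y (chi i)] = 0].
Proof.
case: d th j => [|d] th j r2 rd; first by case: j.
have /choice[w hw] : forall cp : {ffun 'I_n -> 'I_r} * {ffun 'I_r -> 'I_(r - 2)},
  exists g : {mpoly F[d.+1]}, [/\ g != 0, free_of j g & forall z : 'I_(r - 2) -> F,
    (g \mPo th).@[fun i => z (cp.2 (cp.1 i))] = 0].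
  move=> [chi phi].
  (* Here the number of parameters is [d.+1]: the [d] others, restricted to one stratum, are
     polynomials in [r - 2 < d] variables, hence dependent. The product over all strata is taken
     afterwards. *)
  have [|p pN0 pE] := @mpoly_dep F (r - 2) d
    (fun k => tnth th (lift j k) \mPo [tuple 'X_(phi (chi i)) | i < n]); first by lia.
  exists (p \mPo [tuple 'X_(lift j k) | k < d]); split.
  - apply: contraNneq pN0 => e; apply/eqP/mpoly_eq0_fun => v.
    have := congr1 (meval (fun i => if unlift j i is Some k then v k else 0)) e.
    rewrite meval0 comp_mpoly_meval => <-; apply: meval_eq => k.
    by rewrite tnth_mktuple mevalXU liftK.
  - move=> v v' vv; rewrite !comp_mpoly_meval; apply: meval_eq => k.
    by rewrite tnth_mktuple !mevalXU; apply: vv; rewrite eq_sym neq_lift.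
  - move=> z /=; have := congr1 (meval z) pE; rewrite meval0 => <-.
    rewrite !comp_mpoly_meval; apply: meval_eq => k.
    rewrite !tnth_mktuple mevalXU comp_mpoly_meval; apply: meval_eq => i.
    by rewrite tnth_mktuple mevalXU.
exists (\prod_cp w cp); split.
- by apply/prodf_neq0 => cp _; have [] := hw cp.
- by apply: free_of_prod => cp; have [] := hw cp.
- move=> chi y /(two_coincidences_factor 0 r2)[phi [z yz]].
  rewrite rmorph_prod /= rmorph_prod /= (bigD1 (chi, phi)) //=.
  have [_ _ h] := hw (chi, phi).
  rewrite (meval_eq (v2 := fun i => z (phi (chi i)))); last by move=> i; rewrite yz.
  by rewrite h mul0r.
Qed.

(** * Under Cohen--Macaulayness the test function is the restriction of a polynomial *)

Lemma msym_comp (F : comNzRingType) n (s : 'S_n) (p : {mpoly F[n]}) :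
  msym s p = p \mPo [tuple 'X_(s i) | i < n].
Proof.
rewrite /msym /comp_mpoly /mmap; apply: eq_bigr => m _; congr (_ * _).
by apply: mmap1_eq => i; rewrite tnth_mktuple.
Qed.

Lemma meval_msym (F : comNzRingType) n (s : 'S_n) (p : {mpoly F[n]}) x :
  (msym s p).@[x] = p.@[fun i => x (s i)].
Proof.
rewrite msym_comp comp_mpoly_meval; apply: meval_eq => i.
by rewrite tnth_mktuple mevalXU.
Qed.

Section Main.
Context (F : numFieldType) (n : nat) (l : seq nat).
Local Notation r := (size l).
Local Notation lam := (nth 0%N l).
Hypothesis ln : sumn l = n.
Hypothesis l0 : all (fun a => 0 < a)%N l.
Hypothesis r2 : (2 < r)%N.
Context (al : 'I_3 -> nat) (f0 : {mpoly F[3]}).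
Hypothesis alI : injective al.
Hypothesis al0 : forall i, (0 < al i)%N.
Hypothesis al_sum : forall i j (p : 'I_r), i != j -> (al i + al j)%N != lam p.
Hypothesis f0qi : quasi_inv al f0.
Context (S : {mpoly F[n]} -> Prop).
Local Notation I := (vanish (@in_X F n l)).
Local Notation test := (test_fun l al f0).
Local Notation cond := (conductor l al f0).
Implicit Type chi : {ffun 'I_n -> 'I_r}.
Hypothesis SC : forall c, S c%:MP.
Hypothesis SD : forall p q, S p -> S q -> S (p + q).
Hypothesis SM : forall p q, S p -> S q -> S (p * q).
Hypothesis Spi : forall d p, S p -> S (pihomog mdeg d p).
Hypothesis Ssym : forall p, p \is symmetric -> S p.
Hypothesis Stest : forall c H, S c ->
  (forall chi, content chi -> forall y, H.@[fun i => y (chi i)] = c.@[fun i => y (chi i)] * test.@[y]) ->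
  S H.

Lemma vanishP p : I p <-> forall chi, content chi -> forall y, p.@[fun i => y (chi i)] = 0.
Proof.
split=> [Ip chi hc y|h x /(in_XP ln l0)[chi [hc [y ->]]]]; last exact: h.
by apply: Ip; apply/(in_XP ln l0); exists chi; split=> //; exists y.
Qed.

(** A symmetric multiplier that is nonzero at the general point of every component; it allows the
    last cancellation in [test_fun_polynomial]. *)
Definition discr : {mpoly F[n]} := \sum_(chi : {ffun 'I_n -> 'I_r} | content chi) ker_prod F chi.

Lemma cross_sym (s : 'S_n) (e : rel 'I_n) :
  msym s (cross_prod F e) = cross_prod F (fun i j => e ((s^-1)%g i) ((s^-1)%g j)).
Proof.
rewrite msym_comp rmorph_prod /=.
have sI : injective (fun ij : 'I_n * 'I_n => (s ij.1, s ij.2)).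
  by move=> [p q] [p' q'] [/perm_inj -> /perm_inj ->].
rewrite [RHS](reindex_inj sI) /=; apply: eq_big => [[i j]|[i j] _] /=.
  by rewrite !permK.
by rewrite comp_mpolyB !comp_mpolyXU -!tnth_nth !tnth_mktuple.
Qed.

Lemma discr_sym : discr \is symmetric.
Proof.
apply/issymP => s; rewrite /discr raddf_sum /=.
pose G chi : {ffun 'I_n -> 'I_r} := [ffun i => chi ((s^-1)%g i)].
have GI : injective G.
  move=> chi chi' /ffunP e; apply/ffunP => i.
  by have := e (s i); rewrite !ffunE permK.
rewrite [RHS](reindex_inj GI) /=; apply: eq_big => [chi|chi _].
  apply/idP/idP => [hc|/(content_perm s)]; first exact: content_perm.
  by rewrite (_ : [ffun _ => _] = chi) //; apply/ffunP => i; rewrite !ffunE permK.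
by rewrite cross_sym; apply: eq_cross => i j; rewrite !ffunE.
Qed.

(** Two colorings of content [l], one refining the other, have the same kernel, so no blocks merge
    and [cross_conductor] applies to every summand. *)
Lemma discr_cond : cond discr.
Proof.
rewrite /discr; elim/big_rec: _ => [|chi c hc hcond]; first exact: conductor0.
apply: conductorD => //; apply: cross_conductor => //.
- exact: part_pos.
- by move=> i j k; split=> // /eqP ->.
- move=> chi' hc' co p q p' q' pq _ /existsP[i /existsP[j /and3P[/eqP ci /eqP cj e]]] _.
  have [g [gE _]] := content_refine (part_pos l0) hc' hc (fun i j h => eqP (co i j h)).
  by move: pq; rewrite -ci -cj -(inj_eq (@perm_inj _ g)) -!gE e.
Qed.

Lemma discr_neq0 chi (y : 'I_r -> F) : content chi -> injective y ->
  discr.@[fun i => y (chi i)] != 0.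
Proof.
move=> hc yI; rewrite /discr raddf_sum /= (bigID (fun chi' => same_ker chi' chi)) /=.
rewrite [X in _ + X]big1 => [|chi' /andP[hc' nk]]; last exact: (ker_prod_eq0 (part_pos l0)).
rewrite addr0 (eq_bigr (fun _ => (ker_prod F chi).@[fun i => y (chi i)])); last first.
  by move=> chi' /andP[_ /same_kerP sk]; congr (_.@[_]); apply: eq_cross.
rewrite sumr_const -mulr_natl mulf_neq0 //.
  rewrite pnatr_eq0 -lt0n; apply/card_gt0P; exists chi.
  by rewrite unfold_in /= hc; apply/same_kerP.
rewrite meval_cross; apply/prodf_neq0 => -[i j] /= cij.
by rewrite subr_eq0 (inj_eq yI).
Qed.

(** For each equivalence relation [e], either every component merges at most one pair along [e] and
    [cross_conductor] applies, or the points constant on the classes of [e] have two coincidences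
    and [G] vanishes there. *)
Lemma rad_cond (G : {mpoly F[n]}) :
  (forall chi y, two_coincidences y -> G.@[fun i => y (chi i)] = 0) -> rad cond G.
Proof.
move=> hG; apply: rad_arrangement => [|p q|p q|e eqe].
- exact: conductor0.
- exact: conductorD.
- exact: conductorM.
have [[chi [hc [co none]]]|no] := pselect (exists chi, content chi /\
  (coarser chi e /\ ~ at_most_one_merge chi e)); last first.
  left; exists 1%N; rewrite expr1; apply: cross_conductor => //; first exact: part_pos.
  by move=> chi hc co; apply: contrapT => h; apply: no; exists chi.
right=> x xe; have [rep hrep] := content_rep (part_pos l0) hc.
have xy : x =1 fun i => x (rep (chi i)).
  by move=> i; apply: xe; apply: co; rewrite hrep.
rewrite (meval_eq _ xy); apply: (hG chi (fun p => x (rep p))).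
apply: contrapT => no2; apply: none => p q p' q' pq pq' e1 e2; apply: contrapT => ne.
have eqx a b : color_rel chi e a b -> x (rep a) = x (rep b).
  move=> /existsP[i /existsP[j /and3P[/eqP <- /eqP <- eij]]].
  by rewrite -!xy; exact: xe.
by apply: no2; exists p, q, p', q'; split=> //; exact: eqx.
Qed.

Theorem test_fun_polynomial : graded_CM S I ->
  exists Phi : {mpoly F[n]}, Phi \is symmetric /\
    forall chi, content chi -> forall y, Phi.@[fun i => y (chi i)] = test.@[y].
Proof.
move=> CM; have [ths [Sths [T [A [b [Sb gen free]]]]]] := graded_CM_free (@in_X_scale n l F) SC SD SM Spi CM.
pose d := size ths; pose th := in_tuple ths; rewrite -/d -/th in gen free.
have Sth i : S (tnth th i) by apply: Sths; exact: mem_tnth.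
have Scm (u : {mpoly F[d]}) : S (u \mPo th) by apply: sub_comp.
have hc0 := block_content ln; set chi0 := block_coloring ln in hc0.
have [rep0 hrep0] := content_rep (part_pos l0) hc0.
have rd : (r <= d)%N.
  apply: (@param_count F n r d chi0 rep0 S T A b th) => // D a Sa aD.
  have [u [uD /vanishP uI]] := gen D a Sa aD; exists u; split=> // y.
  by apply/eqP; rewrite -subr_eq0 -mevalB uI.
have genS a : S a -> exists u : T -> {mpoly F[d]}, I (a - \sum_(i in A) (u i \mPo th) * b i).
  by move=> Sa; have [u [_ h]] := gen (msize a) a Sa (leqnSn _); exists u.
have uniq_rep (u v : T -> {mpoly F[d]}) :
    I (\sum_(i in A) (u i \mPo th) * b i - \sum_(i in A) (v i \mPo th) * b i) ->
    forall i, i \in A -> u i = v i.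
  move=> h i iA; apply/eqP; rewrite -subr_eq0; apply/eqP.
  apply: (free (fun i => u i - v i)) iA; rewrite -sumrB in h.
  rewrite (eq_bigr (fun i => (u i \mPo th) * b i - (v i \mPo th) * b i)) // => j _.
  by rewrite raddfB mulrBl.
have d0 : (0 < d)%N by apply: leq_trans rd; apply: leq_trans r2.
pose j0 : 'I_d := Ordinal d0.
have /choice[g hg] : forall j : 'I_d, exists g : {mpoly F[d]},
    [/\ g != 0, free_of j g & cond (g \mPo th)].
  move=> j; have [g [gN0 gj gE]] := @stratum_relation F n r d th j r2 rd.
  have [N hN] := rad_cond gE.
  exists (g ^+ N); split; [exact: expf_neq0 | exact: free_of_exp | by rewrite rmorphXn].
have /choice[H hH] : forall j, exists H : {mpoly F[n]}, forall chi, content chi -> forall y,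
    H.@[fun i => y (chi i)] = (g j \mPo th).@[fun i => y (chi i)] * test.@[y].
  by move=> j; have [_ _ [H hH]] := hg j; exists H.
have SH j : S (H j) by apply: (Stest (Scm (g j))); exact: hH.
have /choice[u hu] := fun j => genS _ (SH j).
have hu' j chi y : content chi -> (\sum_(i in A) (u j i \mPo th) * b i).@[fun i => y (chi i)] =
    (g j \mPo th).@[fun i => y (chi i)] * test.@[y].
  move=> hc; have /vanishP/(_ _ hc y) := hu j.
  by rewrite mevalB hH // => /eqP; rewrite subr_eq0 => /eqP <-.
have scale (q : {mpoly F[d]}) (v : T -> {mpoly F[d]}) :
    \sum_(i in A) ((q * v i) \mPo th) * b i = (q \mPo th) * \sum_(i in A) (v i \mPo th) * b i.
  by rewrite mulr_sumr; apply: eq_bigr => i _; rewrite rmorphM /= mulrA.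
have gu i j t : t \in A -> g i * u j t = g j * u i t.
  move: t; apply: (uniq_rep (fun t => g i * u j t) (fun t => g j * u i t)).
  apply/vanishP => chi hc y; rewrite mevalB !scale !mevalM !hu' //.
  by rewrite mulrCA subrr.
have /choice[phi hphi] : forall t, exists phi, t \in A -> forall j, u j t = g j * phi.
  move=> t; have [tA|_] := boolP (t \in A); last by exists 0.
  have [||i j|phi hphi] := @common_quotient F d j0 g (fun j => u j t).
  - by move=> j; have [] := hg j.
  - by move=> j m; have [_ gj _] := hg j; exact: free_of_msupp.
  - exact: gu.
  by exists phi => _.
pose Phi0 := \sum_(i in A) (phi i \mPo th) * b i.
have SPhi0 : S Phi0.
  by apply: (sub_sum SC SD) => i _; apply: SM.
have gPhi chi y : content chi -> (g j0 \mPo th).@[fun i => y (chi i)] * Phi0.@[fun i => y (chi i)] =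
    (g j0 \mPo th).@[fun i => y (chi i)] * test.@[y].
  move=> hc; rewrite -hu' // -mevalM -scale; congr (_.@[_]).
  by apply: eq_bigr => t tA; rewrite (hphi t tA).
have [Hd hHd] := discr_cond; have Sd : S discr by apply/Ssym/discr_sym.
have SHd : S Hd by apply: (Stest Sd); exact: hHd.
(* [test] is not yet known to come from [S], so freeness does not cancel [g j0] in [gPhi], and
   nothing so far prevents [g j0] from vanishing on a component. But [discr * Phi0 - Hd] lies in [S]
   and is killed by [g j0], so it is 0 on X, and [discr] can then be cancelled on each component. *)
have [w hw] := genS (discr * Phi0 - Hd) (SD (SM Sd SPhi0) (sub_opp SC SM SHd)).
have w0 t : t \in A -> w t = 0.
  move=> tA; have [gN0 _ _] := hg j0; apply: (mulf_eq0r gN0).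
  move: t tA; apply: (free (fun t => g j0 * w t)); apply/vanishP => chi hc y.
  rewrite scale mevalM; have /vanishP/(_ _ hc y) := hw.
  rewrite mevalB => /eqP; rewrite subr_eq0 => /eqP <-.
  by rewrite mevalB mevalM hHd // mulrBr mulrCA gPhi // mulrCA subrr.
have dPhi chi y : content chi -> discr.@[fun i => y (chi i)] * (Phi0.@[fun i => y (chi i)] - test.@[y]) = 0.
  move=> hc; have /vanishP/(_ _ hc y) := hw; rewrite big1 ?subr0 => [|t tA]; last first.
    by rewrite w0 // comp_mpoly0 mul0r.
  by rewrite mevalB mevalM hHd // mulrBr.
have Phi0E chi y : content chi -> Phi0.@[fun i => y (chi i)] = test.@[y].
  move=> hc; pose tX := [tuple 'X_(chi i) | i < n] : n.-tuple {mpoly F[r]}.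
  have tXE (p : {mpoly F[n]}) z : (p \mPo tX).@[z] = p.@[fun i => z (chi i)].
    by rewrite comp_mpoly_meval; apply: meval_eq => i; rewrite tnth_mktuple mevalXU.
  apply/eqP; rewrite -subr_eq0 -tXE -mevalB; apply/eqP.
  rewrite (_ : (Phi0 \mPo tX) - test = 0) ?meval0 //.
  have dN0 : discr \mPo tX != 0.
    pose y0 (p : 'I_r) : F := (p : nat)%:R.
    have y0I : injective y0 by move=> p q /eqP; rewrite eqr_nat => /eqP /val_inj.
    by apply: contraNneq (discr_neq0 hc y0I) => e; rewrite -tXE e meval0.
  apply: (mulf_eq0r dN0); apply: mpoly_eq0_fun => z.
  by rewrite mevalM mevalB !tXE dPhi.
(* Averaging keeps the values, because permuting coordinates only changes the coloring and [test] is
   the same for all colorings. *)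
exists (n`!%:R^-1 *: \sum_(s : 'S_n) msym s Phi0); split.
  apply: rpredZ; apply/issymP => s; rewrite raddf_sum /= [RHS](reindex_inj (@mulIg _ s)) /=.
  by apply: eq_bigr => t _; rewrite msymMm.
move=> chi hc y; rewrite mevalZ raddf_sum /= (eq_bigr (fun _ => test.@[y])) => [|s _]; last first.
  rewrite meval_msym; pose chi' : {ffun 'I_n -> 'I_r} := [ffun i => chi (s i)].
  rewrite -(Phi0E chi'); last exact: content_perm.
  by apply: meval_eq => i; rewrite ffunE.
rewrite sumr_const -[X in _ * X]mulr_natl mulrA card_Sn mulVf ?mul1r //.
by rewrite pnatr_eq0 -lt0n fact_gt0.
Qed.
End Main.

(** * The degree-five term of a symmetric polynomial at a triple collision *)

Lemma poly_of_mpoly (F : fieldType) m (p : {mpoly F[m]}) (v : 'I_m -> {poly F}) :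
  exists P : {poly F}, forall s, P.[s] = p.@[fun i => (v i).[s]].
Proof.
exists (\sum_(k <- msupp p) p@_k *: \prod_i v i ^+ k i) => s.
rewrite horner_sum mevalE; apply: eq_bigr => k _; rewrite hornerZ horner_prod.
by congr (_ * _); apply: eq_bigr => i _; rewrite horner_exp.
Qed.

Lemma coef_mesym (F : fieldType) n (x : 'I_n -> F) k :
  (\prod_i (1 + x i *: 'X))`_k = (mesym n F k).@[x].
Proof.
rewrite (eq_bigr (fun i => x i *: 'X + 1)) => [|i _]; last by rewrite addrC.
rewrite bigA_distr coef_sum /mesym raddf_sum /= [LHS](bigID (fun J : {set 'I_n} => #|J| == k)) /=.
have E (J : {set 'I_n}) : \prod_i (if i \in J then x i *: 'X else 1) =
    (\prod_(i in J) x i) *: 'X^#|J| :> {poly F}.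
  by rewrite -big_mkcond /= scaler_prod prodr_const.
rewrite [X in _ + X]big1 ?addr0 => [|J Jk]; last first.
  by rewrite E coefZ coefXn eq_sym (negPf Jk) mulr0.
apply: eq_bigr => J /eqP Jk; rewrite E coefZ coefXn Jk eqxx mulr1 rmorph_prod /=.
by apply: eq_bigr => i _; rewrite mevalXU.
Qed.

Lemma coef_scaleX (F : fieldType) (p : {poly F}) s j : (p \Po (s *: 'X))`_j = s ^+ j * p`_j.
Proof.
rewrite comp_polyE coef_sum.
rewrite (eq_bigr (fun i : 'I_(size p) => if (i : nat) == j then s ^+ j * p`_j else 0)); last first.
  move=> i _; rewrite exprZn scalerA coefZ coefXn eq_sym.
  by case: eqP => [->|_]; rewrite ?mulr1 ?mulr0 // mulrC.
have [jp|pj] := ltnP j (size p); last first.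
  rewrite (nth_default _ pj) mulr0 big1 // => i _; case: eqP => // e.
by rewrite -big_mkcond /= (big_pred1 (Ordinal jp)).
Qed.

Section Taylor.
Context (F : numFieldType) (al : 'I_3 -> nat).

(** The k-th elementary symmetric function of the [z i], each repeated [al i] times. *)
Definition eps (z : 'I_3 -> F) k : F := (\prod_i (1 + z i *: 'X) ^+ al i)`_k.

Lemma eps0 z : eps z 0 = 1.
Proof.
rewrite /eps -horner_coef0 horner_prod big1 // => i _.
by rewrite horner_exp hornerD hornerZ hornerX mulr0 addr0 hornerC expr1n.
Qed.

Lemma eps1 z : eps z 1 = \sum_i (al i)%:R * z i.
Proof.
have mul (p q : {poly F}) x y : p`_0 = 1 -> p`_1 = x -> q`_0 = 1 -> q`_1 = y ->
    (p * q)`_0 = 1 /\ (p * q)`_1 = x + y.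
  move=> p0 p1 q0 q1; rewrite !coefM !big_ord_recl !big_ord0 /= /bump /= p0 p1 q0 q1.
  by rewrite mulr1 !mul1r mulr1 !addr0 addrC.
have one0 : (1 : {poly F})`_0 = 1 by rewrite coef1.
have one1 : (1 : {poly F})`_1 = 0 by rewrite coef1.
have pow i m : ((1 + z i *: 'X) ^+ m)`_0 = 1 /\ ((1 + z i *: 'X) ^+ m)`_1 = m%:R * z i.
  elim: m => [|m [IH0 IH1]]; first by rewrite expr0 mul0r.
  rewrite exprS (_ : m.+1%:R * z i = z i + m%:R * z i); last by rewrite mulrS mulrDl mul1r.
  by apply: mul => //; rewrite coefD coefZ coefX coef1 ?mulr0 ?addr0 // mulr1 add0r.
suff [] : (\prod_i (1 + z i *: 'X) ^+ al i)`_0 = 1 /\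
    (\prod_i (1 + z i *: 'X) ^+ al i)`_1 = \sum_i (al i)%:R * z i by [].
elim/big_rec2: _ => [//|i x p _ [p0 p1]]; have [h0 h1] := pow i (al i); exact: mul.
Qed.

Definition balanced (z : 'I_3 -> F) := \sum_i (al i)%:R * z i = 0.

(* The coefficients up to degree five of a polynomial in the [s ^+ j * eps z j],
   [j <> 1]. *)
Definition taylor (g : ('I_3 -> F) -> F -> F) := exists c0 c2 c3 c4 c22 c5 c23 : F,
  forall z, balanced z -> exists P : {poly F}, (forall s, P.[s] = g z s) /\
  [/\ P`_0 = c0, P`_1 = 0, P`_2 = c2 * eps z 2, P`_3 = c3 * eps z 3 &
      P`_4 = c4 * eps z 4 + c22 * eps z 2 ^+ 2 /\
      P`_5 = c5 * eps z 5 + c23 * (eps z 2 * eps z 3)].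

Lemma taylor_ext g g' : (forall z s, g z s = g' z s) -> taylor g -> taylor g'.
Proof.
move=> e [c0 [c2 [c3 [c4 [c22 [c5 [c23 h]]]]]]]; exists c0, c2, c3, c4, c22, c5, c23 => z bz.
by have [P [hP cP]] := h z bz; exists P; split=> // s; rewrite hP e.
Qed.

Lemma taylorC c : taylor (fun _ _ => c).
Proof.
exists c, 0, 0, 0, 0, 0, 0 => z _; exists c%:P; split=> [s|]; first by rewrite hornerC.
by rewrite !coefC /= !mul0r !addr0.
Qed.

Lemma taylorD g g' : taylor g -> taylor g' -> taylor (fun z s => g z s + g' z s).
Proof.
move=> [c0 [c2 [c3 [c4 [c22 [c5 [c23 h]]]]]]] [d0 [d2 [d3 [d4 [d22 [d5 [d23 h']]]]]]].
exists (c0 + d0), (c2 + d2), (c3 + d3), (c4 + d4), (c22 + d22), (c5 + d5), (c23 + d23) => z bz.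
have [P [hP [p0 p1 p2 p3 [p4 p5]]]] := h z bz.
have [Q [hQ [q0 q1 q2 q3 [q4 q5]]]] := h' z bz.
exists (P + Q); split=> [s|]; first by rewrite hornerD hP hQ.
rewrite !coefD p0 p1 p2 p3 p4 p5 q0 q1 q2 q3 q4 q5.
by split; [ | | | | split]; ring.
Qed.

(** Up to weight five the only products of the [eps z j] with j >= 2 are [eps z 2 ^+ 2] and
    [eps z 2 * eps z 3], so the shape is stable. *)
Lemma taylorM g g' : taylor g -> taylor g' -> taylor (fun z s => g z s * g' z s).
Proof.
move=> [c0 [c2 [c3 [c4 [c22 [c5 [c23 h]]]]]]] [d0 [d2 [d3 [d4 [d22 [d5 [d23 h']]]]]]].
exists (c0 * d0), (c0 * d2 + c2 * d0), (c0 * d3 + c3 * d0), (c0 * d4 + c4 * d0),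
  (c0 * d22 + c2 * d2 + c22 * d0), (c0 * d5 + c5 * d0),
  (c0 * d23 + c2 * d3 + c3 * d2 + c23 * d0) => z bz.
have [P [hP [p0 p1 p2 p3 [p4 p5]]]] := h z bz.
have [Q [hQ [q0 q1 q2 q3 [q4 q5]]]] := h' z bz.
exists (P * Q); split=> [s|]; first by rewrite hornerM hP hQ.
rewrite !coefM !big_ord_recl !big_ord0 /= /bump /=.
rewrite p0 p1 p2 p3 p4 p5 q0 q1 q2 q3 q4 q5.
by split; [ | | | | split]; ring.
Qed.

Lemma taylor_sum (I : Type) (s : seq I) g :
  (forall i, taylor (g i)) -> taylor (fun z t => \sum_(i <- s) g i z t).
Proof.
move=> h; elim: s => [|i s IH].
  by apply: taylor_ext (taylorC 0) => z t; rewrite big_nil.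
by apply: taylor_ext (taylorD (h i) IH) => z t; rewrite big_cons.
Qed.

Lemma taylor_prod (I : Type) (s : seq I) g :
  (forall i, taylor (g i)) -> taylor (fun z t => \prod_(i <- s) g i z t).
Proof.
move=> h; elim: s => [|i s IH].
  by apply: taylor_ext (taylorC 1) => z t; rewrite big_nil.
by apply: taylor_ext (taylorM (h i) IH) => z t; rewrite big_cons.
Qed.

Lemma taylorX g k : taylor g -> taylor (fun z t => g z t ^+ k).
Proof.
move=> h; elim: k => [|k IH]; first by apply: taylor_ext (taylorC 1) => z t; rewrite expr0.
by apply: taylor_ext (taylorM h IH) => z t; rewrite exprS.
Qed.

Lemma taylor_mpoly m (p : {mpoly F[m]}) v :
  (forall k, taylor (v k)) -> taylor (fun z s => p.@[fun k => v k z s]).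
Proof.
move=> h; apply: (@taylor_ext (fun z s =>
  \sum_(k <- msupp p) p@_k * \prod_i v i z s ^+ k i)); first by move=> z s; rewrite mevalE.
apply: taylor_sum => k; apply: taylorM; first exact: taylorC.
by apply: taylor_prod => i; exact: taylorX.
Qed.

Lemma taylor_eps j : taylor (fun z s => s ^+ j * eps z j).
Proof.
pose c k : F := (j == k)%:R.
exists (c 0%N), (c 2%N), (c 3%N), (c 4%N), 0, (c 5%N), 0 => z bz; exists (eps z j *: 'X^j); split=> [s|].
  by rewrite hornerZ hornerXn mulrC.
rewrite !coefZ !coefXn /c ![_ == j]eq_sym !mul0r !addr0.
case: j c => [|[|[|[|[|[|j]]]]]] c /=; rewrite ?mulr0 ?mulr1 ?mul0r ?mul1r ?eps0 ?eps1 //.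
Qed.

Lemma dvd_coef (P Q : {poly F}) : 'X^6 %| P -> (P * Q)`_5 = 0.
Proof.
by move=> /dvdpP[R ->]; rewrite mulrAC mulrC coefXnM.
Qed.
End Taylor.

Section Coefficient.
Context (F : numFieldType) (n : nat) (l : seq nat).
Local Notation r := (size l).
Local Notation lam := (nth 0%N l).
Context (al : 'I_3 -> nat) (f0 : {mpoly F[3]}).
Hypothesis alI : injective al.
Hypothesis al0 : forall i, (0 < al i)%N.
Hypothesis f0hom : f0 \is 5.-homog.
Context (t0 : {ffun 'I_3 -> 'I_r}).
Hypothesis t0al : forall i, lam (t0 i) = al i.

Lemma t0I : injective t0.
Proof. by move=> i j e; apply: alI; rewrite -!t0al e. Qed.

(* A curve through the stratum on which the three parts of [t0] collide. *)
Definition curve (z : 'I_3 -> F) (p : 'I_r) : {poly F} :=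
  if [pick i | t0 i == p] is Some i then z i *: 'X else (p.+1)%:R%:P.

Lemma curve_in z i : curve z (t0 i) = z i *: 'X.
Proof.
by rewrite /curve; case: pickP => [j /eqP/t0I -> //|/(_ i)]; rewrite eqxx.
Qed.

Lemma curve_out z p : p \notin codom t0 -> curve z p = (p.+1)%:R%:P.
Proof.
rewrite /curve; case: pickP => [j /eqP <-|//]; by rewrite codom_f.
Qed.

Lemma prod_codom (R : comPzSemiRingType) (G : 'I_r -> R) :
  \prod_p G p = (\prod_i G (t0 i)) * \prod_(p | p \notin codom t0) G p.
Proof.
rewrite (bigID (mem (codom t0))) /=; congr (_ * _).
rewrite (eq_bigl (mem [set t0 i | i in setT])) => [|p]; last first.
  by apply/codomP/imsetP => [[i ->]|[i _ ->]]; exists i.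
rewrite big_imset /=; last by move=> i j _ _; exact: t0I.
by apply: eq_bigl => i; rewrite inE.
Qed.

(** The generating function of the elementary symmetric polynomials splits into the factor of the
    colliding blocks, which yields [s ^+ j * eps al z j], and the factor [Q] of the fixed blocks,
    which is constant in s and z. *)
Lemma taylor_mesym (chi : {ffun 'I_n -> 'I_r}) k : content chi ->
  taylor al (fun z s => (mesym n F k).@[fun i => (curve z (chi i)).[s]]).
Proof.
move=> hc; pose Q : {poly F} := \prod_(p | p \notin codom t0) (1 + (p.+1)%:R *: 'X) ^+ lam p.
apply: (@taylor_ext _ _ (fun z s => \sum_(j < k.+1) (s ^+ j * eps al z j) * Q`_(k - j))).
  move=> z s; rewrite -coef_mesym.
  rewrite (partition_big chi predT) //= (eq_bigr (fun p => (1 + (curve z p).[s] *: 'X) ^+ lam p)).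
    rewrite prod_codom [\prod_(p | p \notin codom t0) _](_ : _ = Q); last first.
      by apply: eq_bigr => p hp; rewrite curve_out // hornerC.
    rewrite (_ : \prod_i _ = (\prod_i (1 + z i *: 'X) ^+ al i) \Po (s *: 'X)).
      by rewrite coefM; apply: eq_bigr => j _; rewrite coef_scaleX.
    rewrite rmorph_prod /=; apply: eq_bigr => i _.
    rewrite curve_in t0al rmorphXn /= rmorphD rmorph1 /= comp_polyZ comp_polyX.
    by rewrite hornerZ hornerX scalerA.
  move=> p _; rewrite (eq_bigr (fun _ => 1 + (curve z p).[s] *: 'X)); last by move=> i /eqP ->.
  by rewrite prodr_const; congr (_ ^+ _); rewrite -(contentP p hc).
by apply: taylor_sum => j; apply: taylorM; [exact: taylor_eps | exact: taylorC].
Qed.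

Definition curve_prod (t : {ffun 'I_3 -> 'I_r}) z : {poly F} :=
  \prod_(pq : 'I_r * 'I_r | ~~ merge t pq.1 pq.2)
     (curve z pq.1 - curve z pq.2) ^+ (lam pq.1 * lam pq.2).

Lemma horner_curve_prod t z s :
  (curve_prod t z).[s] = (color_prod F (merge t)).@[fun p => (curve z p).[s]].
Proof.
rewrite meval_color horner_prod; apply: eq_bigr => pq _.
by rewrite horner_exp hornerD hornerN.
Qed.

(** A different triple misses some [t0 i], because its sizes fix the places of its members. The
    product then contains the differences of [t0 i] with [t0 j] and [t0 k] in both orders, of total
    order [2 * al i * (al j + al k)], and this is at least 6 since [al j] and [al k] are distinct
    and positive. *)
Lemma curve_prod_dvd t z : triple al t -> t != t0 -> 'X^6 %| curve_prod t z.
Proof.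
move=> /forallP ht tt0; have [i iN] : exists i, t0 i \notin codom t.
  apply: contrapT => no; case/eqP: tt0; apply/ffunP => i.
  have /codomP[m mE] : t0 i \in codom t.
    by apply: contrapT => /negP h; apply: no; exists i.
  by rewrite mE; congr (t _); apply: alI; rewrite -t0al mE (eqP (ht m)).
have [j [ji [k [ki kj]]]] : exists j, j != i /\ exists k, k != i /\ k != j.
  have [j ij] : exists j, i != j.
    by case: i {iN} => [[|[|[|//]]] hi]; [exists (@Ordinal 3 1 isT)|exists ord0|exists ord0].
  by have [k [ki kj _]] := third_index ij; exists j; rewrite eq_sym; split=> //; exists k.
have nm a b : (a \notin codom t) || (b \notin codom t) -> a != b -> ~~ merge t a b.
  by rewrite /merge negb_or negb_and => h ->.
have pair a b : curve z (t0 a) - curve z (t0 b) = (z a - z b) *: 'X.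
  by rewrite !curve_in scalerBl.
have dvd a b m : 'X^m %| (curve z (t0 a) - curve z (t0 b)) ^+ m.
  by rewrite pair exprZn -mul_polyC dvdp_mulIr.
have eij : (t0 i == t0 j) = false by rewrite (inj_eq t0I) eq_sym (negPf ji).
have eji : (t0 j == t0 i) = false by rewrite (inj_eq t0I) (negPf ji).
have eki : (t0 k == t0 i) = false by rewrite (inj_eq t0I) (negPf ki).
have eik : (t0 i == t0 k) = false by rewrite eq_sym eki.
have ekj : (t0 k == t0 j) = false by rewrite (inj_eq t0I) (negPf kj).
have mij : ~~ merge t (t0 i) (t0 j) by rewrite nm ?iN ?eij.
have mji : ~~ merge t (t0 j) (t0 i) by rewrite nm ?iN ?orbT ?eji.
have mik : ~~ merge t (t0 i) (t0 k) by rewrite nm ?iN ?eik.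
have mki : ~~ merge t (t0 k) (t0 i) by rewrite nm ?iN ?orbT ?eki.
rewrite /curve_prod (bigD1 (t0 i, t0 j)) //= (bigD1 (t0 j, t0 i)) /=; last first.
  by rewrite mji xpair_eqE eji.
rewrite (bigD1 (t0 i, t0 k)) /=; last by rewrite mik !xpair_eqE ekj eij andbF.
rewrite (bigD1 (t0 k, t0 i)) /=; last by rewrite mki !xpair_eqE eki ekj.
rewrite !t0al !mulrA; apply: dvdp_mulr.
apply: (@dvdp_trans _ ('X^(al i * al j) * 'X^(al j * al i) * 'X^(al i * al k) * 'X^(al k * al i))).
  rewrite -!exprD dvdp_exp2l //.
  have jk : al j != al k by rewrite (inj_eq alI) eq_sym.
  have := al0 i; have := al0 j; have := al0 k; move: (al i) (al j) (al k) jk => a b c /eqP bc c0 b0 a0.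
  have bc3 : (3 <= b + c)%N by clear -b0 c0 bc; lia.
  have h : (1 * 3 <= a * (b + c))%N by apply: leq_mul.
  by rewrite [(b * a)%N]mulnC [(c * a)%N]mulnC; clear -h; rewrite mulnDr in h; lia.
by rewrite !dvdp_mul.
Qed.

Definition curve_const : F := (color_prod F (merge t0)).@[fun p =>
  if p \in codom t0 then 0 else (p.+1)%:R].

(** The blocks outside the triple stay at distinct nonzero constants while the triple collapses to
    0. *)
Lemma curve_const_neq0 : curve_const != 0.
Proof.
rewrite /curve_const meval_color; apply/prodf_neq0 => -[p q] /=.
rewrite /merge negb_or negb_and => /andP[pq h]; apply: expf_neq0; rewrite subr_eq0.
have [hp|hp] := boolP (p \in codom t0); have [hq|hq] := boolP (q \in codom t0).
- by rewrite hp hq in h.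
- by rewrite eq_sym pnatr_eq0.
- by rewrite pnatr_eq0.
- by rewrite eqr_nat eqSS; exact: pq.
Qed.

Lemma curve_prod_const z : (curve_prod t0 z)`_0 = curve_const.
Proof.
rewrite -horner_coef0 horner_curve_prod; apply: meval_eq => p.
case: ifP => [/codomP[i ->]|/negbT hp]; first by rewrite curve_in hornerZ hornerX mulr0.
by rewrite curve_out // hornerC.
Qed.

Lemma coef_test z : exists P : {poly F},
  (forall s, P.[s] = (test_fun l al f0).@[fun p => (curve z p).[s]]) /\
  P`_5 = f0.@[z] * curve_const.
Proof.
have /choice[Pf hPf] := fun t : {ffun 'I_3 -> 'I_r} => poly_of_mpoly f0 (fun i => curve z (t i)).
pose P t := (if t == t0 then f0.@[z] *: 'X^5 else Pf t) * curve_prod t z.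
exists (\sum_(t | triple al t) P t); split=> [s|].
  rewrite meval_test horner_sum; apply: eq_bigr => t _; rewrite hornerM horner_curve_prod.
  congr (_ * _); case: eqP => [->|_]; last exact: hPf.
  rewrite hornerZ hornerXn mulrC -(homog_scale _ _ f0hom).
  by apply: meval_eq => i; rewrite curve_in hornerZ hornerX mulrC.
have tt0 : triple al t0 by apply/forallP => i; rewrite t0al.
rewrite coef_sum (bigD1 t0) //= [X in _ + X]big1 ?addr0 => [|t /andP[ht tt]].
  by rewrite /P eqxx -scalerAl coefZ coefXnM /= subnn curve_prod_const.
by rewrite /P mulrC dvd_coef // curve_prod_dvd.
Qed.

(** A symmetric polynomial is a polynomial in the elementary ones, so it has the shape [taylor]
    along the curve; its coefficient of degree five is compared with the one in [coef_test]. *)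
Lemma test_fun_taylor (chi : {ffun 'I_n -> 'I_r}) (Phi : {mpoly F[n]}) :
  content chi -> Phi \is symmetric ->
  (forall y, Phi.@[fun i => y (chi i)] = (test_fun l al f0).@[y]) ->
  exists k c c' : F, k != 0 /\ forall z, balanced al z ->
    k * f0.@[z] = c * eps al z 5 + c' * (eps al z 2 * eps al z 3).
Proof.
move=> hc /sym_fundamental[t [tE _]] hPhi.
have : taylor al (fun z s => Phi.@[fun i => (curve z (chi i)).[s]]).
  apply: (@taylor_ext _ _ (fun z s =>
    t.@[fun k : 'I_n => (mesym n F k.+1).@[fun i => (curve z (chi i)).[s]]])).
    move=> z s; rewrite -tE comp_mpoly_meval; apply: meval_eq => k.
    by rewrite tnth_mktuple.
  by apply: taylor_mpoly => k; exact: taylor_mesym.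
move=> [c0 [c2 [c3 [c4 [c22 [c5 [c23 h]]]]]]].
exists curve_const, c5, c23; split=> [|z bz]; first exact: curve_const_neq0.
have [P [hP [_ _ _ _ [_ <-]]]] := h z bz; have [Q [hQ Q5]] := coef_test z.
rewrite mulrC -Q5 (_ : Q = P) //; apply/eqP; rewrite -subr_eq0; apply/eqP.
apply: poly_eq0_fun => s; rewrite hornerD hornerN hQ hP.
by rewrite (hPhi (fun p => (curve z p).[s])) subrr.
Qed.
End Coefficient.

(** * Three quasi-invariant forms of degree five *)

Section QuasiInvariant.
Context (F : numFieldType) (al : 'I_3 -> nat).
Hypothesis al0 : forall i, (0 < al i)%N.
Local Notation w i := ((al i)%:R : F).

(* The cofactor of the two squares is the linear form for which the linear term
   in [z_j - z_k] vanishes. *)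
Definition qi (i j k : 'I_3) : {mpoly F[3]} :=
  ('X_i - 'X_j) ^+ 2 * ('X_i - 'X_k) ^+ 2 *
  ((w j + w k) *: 'X_i - w j *: 'X_j - w k *: 'X_k - (2%:R * (w j - w k)) *: ('X_j - 'X_k)).

Lemma meval_qi i j k z : (qi i j k).@[z] = (z i - z j) ^+ 2 * (z i - z k) ^+ 2 *
  ((w j + w k) * z i - w j * z j - w k * z k - 2%:R * (w j - w k) * (z j - z k)).
Proof.
rewrite /qi [LHS]mevalM [in LHS]mevalM !rmorphXn /=.
by rewrite !(mevalB, mevalZ, mevalXU).
Qed.

Lemma qiC i j k z : (qi i j k).@[z] = (qi i k j).@[z].
Proof. by rewrite !meval_qi; ring. Qed.

Lemma qi_homog i j k : qi i j k \is 5.-homog.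
Proof.
have X1 a : ('X_a : {mpoly F[3]}) \is 1.-homog by rewrite dhomogX /= mdeg1.
have B1 a b : ('X_a - 'X_b : {mpoly F[3]}) \is 1.-homog by apply: rpredB.
rewrite /qi (_ : 5 = (1 * 2 + 1 * 2) + 1)%N //; apply: dhomogM.
  by apply: dhomogM; apply: dhomogMn.
by do !apply: rpredB; apply: rpredZ.
Qed.

Lemma quasi_inv_atC f i j k : quasi_inv_at (F := F) al f i j k -> quasi_inv_at (F := F) al f j i k.
Proof.
move=> [c0 [c2 [c3 [c4 [c5 h]]]]]; exists c0, c2, (- c3), c4, (- c5) => z /=.
by rewrite h /= addnC; ring.
Qed.

Lemma quasi_inv_at_ext f g i j k : (forall z, f.@[z] = g.@[z]) ->
  quasi_inv_at (F := F) al f i j k -> quasi_inv_at (F := F) al g i j k.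
Proof.
move=> e [c0 [c2 [c3 [c4 [c5 h]]]]]; exists c0, c2, c3, c4, c5 => z /=.
by rewrite -e h.
Qed.

Lemma wD_neq0 i j : w i + w j != 0.
Proof. by rewrite -natrD pnatr_eq0 -lt0n addn_gt0 al0. Qed.

Lemma qi_at_jk i j k : quasi_inv_at (F := F) al (qi i j k) j k i.
Proof.
have A0 := wD_neq0 j k.
(* With W the relative position and t = z_j - z_k, the form is A^-4 (W^2 + s t W - q t^2)^2 (W - 2 s
   t), in which the terms linear in t cancel. *)
pose A := w j + w k; pose s := w j - w k; pose q := w j * w k.
exists (A ^- 4), ((- 3%:R * s ^+ 2 - 2%:R * q) / A ^+ 4), ((2%:R * s * q - 2%:R * s ^+ 3) / A ^+ 4),
  ((q ^+ 2 + 4%:R * s ^+ 2 * q) / A ^+ 4), ((- 2%:R * s * q ^+ 2) / A ^+ 4) => z /=.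
by rewrite meval_qi natrD /A /s /q; field.
Qed.

Lemma qi_at_ij i j k : quasi_inv_at (F := F) al (qi i j k) i j k.
Proof.
have A0 := wD_neq0 i j.
(* Here t^2 is a factor from the start: the form is A^-3 t^2 (W - w_j t)^2 (m' W + m t), with t =
   z_i - z_j and W the relative position of z_k. *)
pose A := w i + w j; pose m := w j * A + w j * w k + 2%:R * w i * (w j - w k).
pose m' := 2%:R * w j - 3%:R * w k.
exists 0, (m' / A ^+ 3), ((m - 2%:R * w j * m') / A ^+ 3),
  ((w j ^+ 2 * m' - 2%:R * w j * m) / A ^+ 3), (w j ^+ 2 * m / A ^+ 3) => z /=.
by rewrite meval_qi natrD /A /m /m' /A; field.
Qed.

Lemma qi_quasi_inv i j k : i != j -> k != i -> k != j -> quasi_inv al (qi i j k).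
Proof.
move=> ij ki kj i' j' k' ij' ki' kj'.
have all3 m : [|| m == i, m == j | m == k].
  have [k1 [k1i k1j h]] := third_index ij.
  have := h k; rewrite (negPf ki) (negPf kj) /= => /eqP ->; exact: h.
have h2 : quasi_inv_at (F := F) al (qi i j k) i k j.
  by apply: (quasi_inv_at_ext (fun z => qiC i k j z)); exact: qi_at_ij.
case/or3P: (all3 i') ij' ki' kj' => /eqP ->; case/or3P: (all3 j') => /eqP ->;
case/or3P: (all3 k') => /eqP ->; rewrite ?eqxx // => _ _ _.
- exact: qi_at_ij.
- exact: quasi_inv_atC (qi_at_ij i j k).
- exact: qi_at_jk.
- exact: quasi_inv_atC h2.
- exact: quasi_inv_atC (qi_at_jk i j k).
Qed.

(* A balanced point with [z_j = z_k], at which only [qi i j k] does not vanish. *)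
Definition qi_point (i : 'I_3) : 'I_3 -> F :=
  fun m => if m == i then \sum_(p | p != i) w p else - w i.

Lemma sum_others i j k : i != j -> k != i -> k != j ->
  forall G : 'I_3 -> F, \sum_(p | p != i) G p = G j + G k.
Proof.
move=> ij ki kj G; rewrite (bigD1 j) 1?eq_sym //= (bigD1 k) /=; last by rewrite ki kj.
rewrite big1 ?addr0 // => p /andP[/andP[pi pj] pk].
have [k1 [k1i k1j h]] := third_index ij.
have := h k; rewrite (negPf ki) (negPf kj) /= => /eqP kk.
by have := h p; rewrite (negPf pi) (negPf pj) -kk (negPf pk).
Qed.

Lemma qi_point_balanced i : balanced al (qi_point i).
Proof.
rewrite /balanced (bigD1 i) //= /qi_point eqxx.
rewrite [X in _ + X](eq_bigr (fun p => - (w i * w p))); last first.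
  by move=> p /negPf ->; rewrite mulrN mulrC.
by rewrite sumrN -mulr_sumr subrr.
Qed.

Lemma qi_point_neq0 i j k : i != j -> k != i -> k != j -> (qi i j k).@[qi_point i] != 0.
Proof.
move=> ij ki kj; rewrite meval_qi /qi_point eqxx [j == i]eq_sym (negPf ij) (negPf ki).
rewrite (sum_others ij ki kj); set a := w i; set b := w j; set c := w k.
rewrite [X in X != 0](_ : _ = (a + b + c) ^+ 5 * (b + c)); last by ring.
rewrite mulf_neq0 ?expf_neq0 ?wD_neq0 // -natrD -natrD pnatr_eq0 -lt0n.
by rewrite !addn_gt0 al0.
Qed.

Lemma qi_point_eq0 i j k : i != j -> k != i -> k != j -> (qi i j k).@[qi_point j] = 0.
Proof.
move=> ij ki kj; rewrite meval_qi /qi_point (negPf ij) (negPf kj).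
by rewrite subrr expr0n mulr0 mul0r.
Qed.

(* The matrix of the values of the three quasi-invariants at the three points is
   diagonal and invertible, but it has rank at most two if all of them have the
   shape of [test_fun_taylor]. *)
Lemma qi_not_taylor : exists i j k, [/\ i != j, k != i, k != j &
  ~ exists c c1 c2 : F, c != 0 /\ forall z, balanced al z ->
    c * (qi i j k).@[z] = c1 * eps al z 5 + c2 * (eps al z 2 * eps al z 3)].
Proof.
apply: contrapT => no.
have get i j k : i != j -> k != i -> k != j -> exists c c1 c2 : F, c != 0 /\
    forall z, balanced al z ->
    c * (qi i j k).@[z] = c1 * eps al z 5 + c2 * (eps al z 2 * eps al z 3).
  by move=> ij ki kj; apply: contrapT => h; apply: no; exists i, j, k.
pose o0 := @Ordinal 3 0 isT; pose o1 := @Ordinal 3 1 isT; pose o2 := @Ordinal 3 2 isT.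
have [a0 [a1 [a2 [aN0 ha]]]] := get o0 o1 o2 isT isT isT.
have [b0 [b1 [b2 [bN0 hb]]]] := get o1 o0 o2 isT isT isT.
have [c0 [c1 [c2 [cN0 hc]]]] := get o2 o0 o1 isT isT isT.
pose x0 := qi_point o0; pose x1 := qi_point o1; pose x2 := qi_point o2.
have B0 := qi_point_balanced o0; have B1 := qi_point_balanced o1; have B2 := qi_point_balanced o2.
have ha0 := ha _ B0; have ha1 := ha _ B1; have ha2 := ha _ B2.
have hb0 := hb _ B0; have hb1 := hb _ B1; have hb2 := hb _ B2.
have hc0 := hc _ B0; have hc1 := hc _ B1; have hc2 := hc _ B2.
have va := @qi_point_neq0 o0 o1 o2 isT isT isT.
have vb := @qi_point_neq0 o1 o0 o2 isT isT isT.
have vc := @qi_point_neq0 o2 o0 o1 isT isT isT.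
rewrite qi_point_eq0 // mulr0 in ha1; rewrite qiC qi_point_eq0 // mulr0 in ha2.
rewrite qi_point_eq0 // mulr0 in hb0; rewrite qiC qi_point_eq0 // mulr0 in hb2.
rewrite qi_point_eq0 // mulr0 in hc0; rewrite qiC qi_point_eq0 // mulr0 in hc1.
move: ha0 ha1 ha2 hb0 hb1 hb2 hc0 hc1 hc2.
set A := _.@[_] in va *; set B := _.@[_] in vb *; set C := _.@[_] in vc *.
set e0 := eps _ _ 5; set f0 := eps _ _ 2 * _.
set e1 := eps _ (qi_point o1) 5; set f1 := eps _ (qi_point o1) 2 * _.
set e2 := eps _ (qi_point o2) 5; set f2 := eps _ (qi_point o2) 2 * _.
move=> ha0 ha1 ha2 hb0 hb1 hb2 hc0 hc1 hc2.
have : (a0 * A) * (b0 * B) * (c0 * C) != 0 by rewrite !mulf_neq0.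
case/eqP; rewrite ha0 hb1 hc2.
(* A 3 by 3 matrix of rank at most two. The zeros above its diagonal suffice to reduce its
   determinant to the product of the diagonal entries. *)
pose N m q : F := nth 0 [:: a1; b1; c1] m * nth 0 [:: e0; e1; e2] q +
                  nth 0 [:: a2; b2; c2] m * nth 0 [:: f0; f1; f2] q.
have det0 : N 0%N 0%N * (N 1%N 1%N * N 2%N 2%N - N 1%N 2%N * N 2%N 1%N)
  - N 0%N 1%N * (N 1%N 0%N * N 2%N 2%N - N 1%N 2%N * N 2%N 0%N)
  + N 0%N 2%N * (N 1%N 0%N * N 2%N 1%N - N 1%N 1%N * N 2%N 0%N) = 0.
  by rewrite /N /=; ring.
rewrite /N /= -ha1 -ha2 -hb2 !mul0r !subr0 addr0 in det0.
by rewrite -[RHS]det0 mulrA.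
Qed.
End QuasiInvariant.

(** * Choice of the three sizes and conclusion *)

(** With a > b the two largest parts, every number above b other than a is not a part. For a smaller
    part c all sums of two exceed b, and only b + c can equal a. *)
Lemma good_triple n (l : seq nat) : is_partition n l ->
  (4 <= size (undup l))%N \/
   (exists a b c : nat, undup l = [:: a; b; c] /\ a <> (b + c)%N) ->
  exists al : 'I_3 -> nat, [/\ injective al, forall i, al i \in l &
    forall i j, i != j -> (al i + al j)%N \notin l].
Proof.
move=> [sl [pl _]] hl.
have su : sorted gtn (undup l).
  rewrite sorted_pairwise; last by move=> x y z /= h1 h2; exact: ltn_trans h2 h1.
  have := undup_uniq l; have : sorted geq (undup l).
    by apply: (subseq_sorted _ (undup_subseq l)) => // x y z /= h1 h2; exact: leq_trans h2 h1.
  rewrite sorted_pairwise => [|x y z /= h1 h2]; last exact: leq_trans h2 h1.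
  elim: (undup l) => //= x s IH /andP[hx hs] /andP[xs us].
  rewrite IH // andbT; apply/allP => y ys; have /allP/(_ y ys) := hx.
  by rewrite /= leq_eqVlt => /orP[/eqP e|//]; rewrite -e ys in xs.
have [a [b [c [s [au bu cu abc]]]]] : exists a b c s, [/\ a \in undup l, b \in undup l, c \in undup l &
   [/\ (c < b)%N, (b < a)%N, a <> (b + c)%N, undup l = [:: a, b & s] & all (gtn b) s]].
  have two x y s : undup l = [:: x, y & s] -> (y < x)%N /\ all (gtn y) s.
    move=> e; move: su; rewrite e sorted_pairwise /=; last first.
      by move=> u v t /= h1 h2; exact: ltn_trans h2 h1.
    by move=> /andP[/andP[xy _] /andP[ys _]].
  case: hl => [|[a [b [c [e ne]]]]].
    case e: (undup l) => [|a [|b [|c [|d s]]]] // _; rewrite -e.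
    have [ba] := two _ _ _ e; rewrite /= => /and3P[cb db ds].
    have dc : (d < c)%N.
      by move: su; rewrite e /= => /and4P[_ _ dc _].
    have [ac|/eqP ac] := eqVneq a (b + c)%N.
      (* If a = b + c, the fourth part d < c replaces c, as b + d < a. *)
      exists a, b, d, [:: c, d & s]; rewrite e !inE !eqxx ?orbT; split=> //; split=> //=.
        by lia.
      by rewrite cb db.
    by exists a, b, c, [:: c, d & s]; rewrite e !inE !eqxx ?orbT; split=> //; split=> //=; rewrite cb db.
  have [ba bs] := two _ _ _ e; have := bs; rewrite /= andbT => cb.
  by exists a, b, c, [:: c]; rewrite e !inE !eqxx ?orbT.
have [cb ba nabc e bs] := abc.
have c0 : (0 < c)%N by have /allP := pl; apply; rewrite -mem_undup.
have big x : (b < x)%N -> x <> a -> x \notin l.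
  move=> bx xa; rewrite -mem_undup e !inE !negb_or; apply/and3P; split.
  - exact/eqP.
  - by rewrite neq_ltn bx orbT.
  - by apply/negP => /(allP bs) /= xb; rewrite ltnNge ltnW in xb.
exists (fun i : 'I_3 => nth 0%N [:: a; b; c] i); split.
- move=> [[|[|[|//]]] hi] [[|[|[|//]]] hj] /= h; try exact: val_inj; exfalso; lia.
- by move=> [[|[|[|//]]] hi] /=; rewrite -mem_undup.
- by move=> [[|[|[|//]]] hi] [[|[|[|//]]] hj] //= _; apply: big; lia.
Qed.

(** The last condition on [S] holds for invariants modulo the ideal because a permutation of the
    coordinates changes the coloring but not [t]. *)
Lemma not_graded_CM (F : numFieldType) n (l : seq nat) (S : {mpoly F[n]} -> Prop) :
  is_partition n l ->
  (4 <= size (undup l))%N \/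
   (exists a b c : nat, undup l = [:: a; b; c] /\ a <> (b + c)%N) ->
  (forall c, S c%:MP) -> (forall p q, S p -> S q -> S (p + q)) ->
  (forall p q, S p -> S q -> S (p * q)) ->
  (forall d p, S p -> S (pihomog mdeg d p)) -> (forall p, p \is symmetric -> S p) ->
  (forall c H (t : {mpoly F[size l]}), S c ->
    (forall chi : {ffun 'I_n -> 'I_(size l)}, content chi -> forall y,
       H.@[fun i => y (chi i)] = c.@[fun i => y (chi i)] * t.@[y]) -> S H) ->
  ~ graded_CM S (vanish (@in_X F n l)).
Proof.
move=> pl hl SC SD SM Spi Ssym Stest CM.
have [al [alI all al_sum]] := good_triple pl hl.
have [_ [l0 ln]] := pl.
have al0 i : (0 < al i)%N by have /allP := l0; apply.
have [i [j [k [ij ki kj no]]]] := qi_not_taylor F al0.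
have r2 : (2 < size l)%N.
  apply: leq_trans (size_undup l).
  by case: hl => [|[a [b [c [-> _]]]]]; first exact: ltnW.
have al_sum' i1 j1 (p : 'I_(size l)) : i1 != j1 -> (al i1 + al j1)%N != nth 0%N l p.
  by move=> /al_sum; apply: contra => /eqP ->; exact: mem_nth.
have [|Phi [Psym hPhi]] := @test_fun_polynomial F n l ln l0 r2 al (qi F al i j k) alI al0
  al_sum' (qi_quasi_inv F al0 ij ki kj) S SC SD SM Spi Ssym _ CM.
  by move=> c H Sc h; exact: (Stest c H _ Sc h).
have lt m : (index (al m) l < size l)%N by rewrite index_mem.
pose t0 : {ffun 'I_3 -> 'I_(size l)} := [ffun m => Ordinal (lt m)].
have t0al m : nth 0%N l (t0 m) = al m by rewrite ffunE /= nth_index.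
apply: no; apply: (@test_fun_taylor F n l al _ alI al0 (qi_homog F al i j k) t0 t0al
  (block_coloring ln) Phi (block_content ln) Psym).
exact: hPhi (block_content ln).
Qed.

Lemma invariants_not_graded_CM (F : numFieldType) n (l : seq nat) :
  is_partition n l ->
  (4 <= size (undup l))%N \/
   (exists a b c : nat, undup l = [:: a; b; c] /\ a <> (b + c)%N) ->
  ~ graded_CM (invariant_mod (vanish (@in_X F n l))) (vanish (@in_X F n l)).
Proof.
move=> pl hl; have [_ [l0 ln]] := pl; apply: not_graded_CM => //.
- by move=> c s; rewrite msym_comp comp_mpolyC subrr; exact: vanish0.
- by move=> p q hp hq s; rewrite msymD opprD addrACA; apply: vanishD; [exact: hp | exact: hq].
- move=> p q hp hq s; rewrite msymM.
  rewrite (_ : _ - _ = msym s p * (msym s q - q) + q * (msym s p - p)); last by ring.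
  by apply: vanishD; apply: vanishM; [exact: hq | exact: hp].
- move=> d p hp s; rewrite msym_pihomog -pihomogB.
  by apply: vanish_pihomog; [exact: in_X_scale | exact: hp].
- by move=> p /issymP hp s; rewrite hp subrr; exact: vanish0.
- move=> c H t Sc hH s; apply/(vanishP ln l0) => chi hc y.
  rewrite mevalB meval_msym hH //.
  pose chi' : {ffun 'I_n -> 'I_(size l)} := [ffun i => chi (s i)].
  have hc' : content chi' by exact: content_perm.
  have e1 (p : {mpoly F[n]}) : p.@[fun i => y (chi (s i))] = p.@[fun i => y (chi' i)].
    by apply: meval_eq => i; rewrite ffunE.
  have /(vanishP ln l0)/(_ _ hc y) := Sc s; rewrite mevalB meval_msym e1 => c0.
  by rewrite e1 hH // -mulrBl c0 mul0r.
Qed.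

Theorem theorem7p1 (R : realType) (n : nat) (l : seq nat) :
  is_partition n l ->
  ((4 <= size (undup l))%N \/
   (exists a b c : nat, undup l = [:: a; b; c] /\ a <> (b + c)%N)) ->
  ~ XmodS_CM R n l /\ ~ X_CM R n l.
Proof.
move=> pl hl; split; first exact: (@invariants_not_graded_CM (Cx R) n l).
exact: (@not_graded_CM (Cx R) n l (fun _ => True)).
Qed.
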